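(* Suppose $h\in\mathcal{Z}_R(0,c_{\tilde{s}})$, the center of $\mathcal{H}_R(0,c_{\tilde s})$. Then $\text{supp}(h)_{\max}$ is a finite union of finite conjugacy classes in $W(1)$.
   Context: **The group $W$.** Let $F$ be a non-archimedean local field, $\mathbf{G}$ a connected reductive $F$-group, $\mathbf{T}\subseteq\mathbf{G}$ a maximal $F$-split torus, $\mathbf{Z}$ and $\mathbf{N}$ the centralizer and normalizer of $\mathbf{T}$ in $\mathbf{G}$, and $\mathbf{Z}(F)_0$ the unique parahoric subgroup of $\mathbf{Z}(F)$. The Iwahori-Weyl group is $W=\mathbf{N}(F)/\mathbf{Z}(F)_0$. Let $\Sigma$ be the reduced root system (assumed irreducible) attached to it by Bruhat-Tits theory, with simple system $\Delta$, finite Weyl group $W_0$ and set of simple reflections $S_0\subset W_0$. Let $\mathcal{V}=\mathbb{Z}\Sigma^\vee\otimes_{\mathbb{Z}}\mathbb{R}$, and $\Sigma^{\text{aff}}=\Sigma+\mathbb{Z}$ (affine functionals on $\mathcal{V}$), whose null-sets are the hyperplanes. Fix a special vertex $\mathfrak{v}_0\in\mathcal{V}$ stabilized by $W_0$; let $\mathfrak{C}_0$ be the Weyl chamber at $\mathfrak{v}_0$ corresponding to $S_0$ and $\mathfrak{A}_0\subset\mathfrak{C}_0$ the alcove whose closure contains $\mathfrak{v}_0$. Let $W^{\text{aff}}$ be the affine Weyl group of $\Sigma^{\text{aff}}$ and $S^{\text{aff}}\supseteq S_0$ its generating set of reflections in the walls of $\mathfrak{A}_0$. Then $W^{\text{aff}}\subseteq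 W$, $W$ acts on $\mathcal{V}$ extending the action of $W^{\text{aff}}$, and $W=\Lambda\rtimes W_0=W^{\text{aff}}\rtimes\Omega$, where $\Lambda$ is a finitely generated abelian group acting on $\mathcal V$ by translations through a homomorphism $\nu:\Lambda\to\mathcal{V}$, and $\Omega$ is the stabilizer of $\mathfrak{A}_0$ in $W$. The length $\ell$ of $(W^{\text{aff}},S^{\text{aff}})$ extends to $W$ by $\ell(w'\tau)=\ell(w')$ for $w'\in W^{\text{aff}},\tau\in\Omega$. **The group $W(1)$ and the algebra.** Let $Z$ be an arbitrary abelian group and $1\to Z\to W(1)\xrightarrow{\pi}W\to1$ an extension. For $X\subseteq W$ put $X(1)=\pi^{-1}(X)$; put $\ell(\tilde w)=\ell(\pi(\tilde w))$. Let $R$ be a commutative ring; $W(1)$ acts on $R[Z]$ by conjugation, $(\tilde w,c)\mapsto\tilde w(c)$. Let $c_{\tilde s}\in R[Z]$ ($\tilde s\in S^{\text{aff}}(1)$) satisfy $c_{\tilde st}=c_{\tilde s}t$ for $t\in Z$, and $\tilde w(c_{\tilde s})=c_{\tilde w\tilde s\tilde w^{-1}}$ whenever $\tilde w\in W(1)$ and $\tilde w\tilde s\tilde w^{-1}\in S^{\text{aff}}(1)$. $\mathcal{H}_R(0,c_{\tilde s})$ is the $R$-algebra that is free as an $R$-module with basis $(T_{\tilde w})_{\tilde w\in W(1)}$, with (unique) multiplication satisfying $T_{\tilde w}T_{\tilde w'}=T_{\tilde w\tilde w'}$ if $\ell(\tilde w)+\ell(\tilde w')=\ell(\tilde w\tilde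 w')$, and $T_{\tilde s}^2=c_{\tilde s}T_{\tilde s}$ for $\tilde s\in S^{\text{aff}}(1)$, where $c_{\tilde s}=\sum_{t\in Z}c_{\tilde s}(t)t$ is identified with $\sum_{t\in Z}c_{\tilde s}(t)T_t$. **Support.** For $h=\sum_{\tilde w\in W(1)}a_{\tilde w}T_{\tilde w}$ with $a_{\tilde w}\in R$, put $\text{supp}(h)=\{\tilde w\in W(1)\mid a_{\tilde w}\ne0\}$, and let $\text{supp}(h)_{\max}$ be the set of elements of maximal length in $\text{supp}(h)$. *)

(* Defs.v *)
From HB Require Import structures.
From mathcomp Require Import all_boot all_order all_algebra.
From mathcomp Require Import monoid finmap.
From mathcomp Require Import boolp classical_sets functions cardinality.
From mathcomp Require Import reals topology normedtype.

Set Implicit Arguments.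
Unset Strict Implicit.
Unset Printing Implicit Defensive.

Import Order.TTheory GRing.Theory Num.Theory.
Import numFieldNormedType.Exports.

Local Open Scope classical_set_scope.
Local Open Scope ring_scope.

(** Coordinates are chosen on the real vector space V: points are row vectors,
  linear functionals (in particular roots) are column vectors, and coroots are
  row vectors. No Euclidean structure is involved. *)

Section Pairing.
Variables (K : realType) (n : nat).

Definition pairing (a : 'cV[K]_n) (v : 'rV[K]_n) : K := (v *m a) 0 0.

End Pairing.

(** The coroot function is only meaningful on the roots. *)
Record rootSystem (K : realType) (n : nat) := RootSystem {
  roots : seq 'cV[K]_n ;
  coroot : 'cV[K]_n -> 'rV[K]_n ;
  root_neq0 : 0 \notin roots ;
  root_span : (<<roots>> = fullv)%VS ;
  coroot2 : {in roots, forall a, pairing a (coroot a) = 2} ;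
  root_refl : {in roots &, forall a b,
    b - pairing b (coroot a) *: a \in roots} ;
  root_integral : {in roots &, forall a b,
    exists k : int, pairing b (coroot a) = k%:~R} ;
  root_reduced : {in roots, forall a (t : K),
    t *: a \in roots -> t = 1 \/ t = -1} ;
  root_nonempty : exists a, a \in roots ;
  root_irreducible : forall P : pred 'cV[K]_n,
    (exists2 a, a \in roots & P a) ->
    {in roots &, forall a b, P a -> ~~ P b -> pairing b (coroot a) = 0} ->
    {in roots, forall a, P a} }.

Section Affine.
Variables (K : realType) (n : nat) (Phi : rootSystem K n).
Implicit Types (a b : 'cV[K]_n) (k l : int) (v x y : 'rV[K]_n).
Implicit Types (A F : set 'rV[K]_n).

Definition is_simple_system (Delta : seq 'cV[K]_n) : Prop :=
  [/\ {subset Delta <= roots Phi},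
      basis_of fullv Delta &
      {in roots Phi, forall b, exists (m : 'cV[K]_n -> nat) (e : bool),
         b = (-1) ^+ e *: \sum_(a <- Delta) (m a)%:R *: a}].

Definition affroot a k v : K := pairing a v + k%:~R.

Definition hyperplane a k : set 'rV[K]_n := [set v | affroot a k v = 0].

Definition arefl a k v : 'rV[K]_n := v - affroot a k v *: coroot Phi a.

(** The group of transformations of V generated by the affine reflections;
  words suffice as reflections are involutions. *)
Definition affine_weyl : set ('rV[K]_n -> 'rV[K]_n) :=
  [set f | exists2 s : seq ('cV[K]_n * int),
     {in s, forall p, p.1 \in roots Phi} &
     f = foldr (fun p g => arefl p.1 p.2 \o g) id s].

(** Facets, alcoves (chambers of the arrangement) and walls as in Bourbaki,
  Lie V.1: a facet is a class of points lying on the same hyperplanes and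
  strictly on the same side of the others; an alcove is a facet contained in
  no hyperplane; a wall of an alcove is a hyperplane which is the support of a
  facet contained in the closure of the alcove. *)
Definition facet x : set 'rV[K]_n :=
  [set y | {in roots Phi, forall a k,
     Num.sg (affroot a k y) = Num.sg (affroot a k x)}].

Definition is_alcove A : Prop :=
  exists2 x, {in roots Phi, forall a k, ~ hyperplane a k x} & A = facet x.

Definition support F : set 'rV[K]_n :=
  [set v | {in roots Phi, forall a k, F `<=` hyperplane a k -> hyperplane a k v}].

Definition is_wall A a k : Prop :=
  a \in roots Phi /\
  exists2 x, facet x `<=` closure A & support (facet x) = hyperplane a k.

Definition is_special v : Prop :=
  {in roots Phi, forall a, exists k, hyperplane a k v}.

End Affine.

Record apartment (K : realType) (n : nat) := Apartment {
  apt_roots :> rootSystem K n ;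
  simples : seq 'cV[K]_n ;
  v0 : 'rV[K]_n ;
  A0 : set 'rV[K]_n ;
  simplesP : is_simple_system apt_roots simples ;
  v0_special : is_special apt_roots v0 ;
  A0_alcove : is_alcove apt_roots A0 ;
  A0_chamber : A0 `<=` [set v | {in simples, forall a, 0 < pairing a (v - v0)}] ;
  A0_closure : closure A0 v0 }.

Section Groups.
Local Open Scope group_scope.
Variable G : groupType.
Implicit Types (S H N : set G) (x y : G).

Definition is_subgroup H : Prop :=
  H 1 /\ forall x y, H x -> H y -> H (x * y^-1).

Definition generated S : set G := smallest is_subgroup S.

Definition semidirect N H : Prop :=
  [/\ is_subgroup N, is_subgroup H, (forall x y, N x -> N (y * x * y^-1)),
      N `&` H = [set 1] &
      forall w, exists x y, [/\ N x, H y & w = x * y]].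

Definition conj_class x : set G := [set y * x * y^-1 | y in [set: G]].

Definition is_word S x (m : nat) : Prop :=
  exists s : seq G,
    [/\ {in s, forall y, S y}, size s = m & \prod_(y <- s) y = x].

(** [S] is meant to consist of involutions, so words need no inverses. *)
Definition word_length S x : nat :=
  xget 0%N [set m | is_word S x m /\ forall m', is_word S x m' -> (m <= m')%N].

End Groups.

Section SubgroupsOfW.
Variables (K : realType) (n : nat) (A : apartment K n) (W : groupType).
Variables (act : W -> 'rV[K]_n -> 'rV[K]_n) (Waff : set W).

Definition Saff_of : set W :=
  [set s | Waff s /\ exists a k, is_wall A (A0 A) a k /\ act s = arefl A a k].

Definition S0_of : set W :=
  [set s | Waff s /\ exists a k,
     [/\ a \in simples A, hyperplane a k (v0 A) & act s = arefl A a k]].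

Definition Omega_of : set W := [set w | act w @` A0 A = A0 A].

End SubgroupsOfW.

(** The Iwahori-Weyl group of a reductive group over a local field is taken
  through its structure of group acting on the apartment: any group with the
  decompositions Lambda ><| W0 = Waff ><| Omega below is allowed. The inclusion
  of the affine Weyl group in W is encoded by the subgroup [Waff], which the
  action maps bijectively onto it; W0 is the subgroup generated by the elements
  of [Waff] acting as the simple reflections at [v0]. *)
Record iwahoriWeyl (K : realType) (n : nat) (A : apartment K n)
    (W : groupType) := IwahoriWeyl {
  act : W -> 'rV[K]_n -> 'rV[K]_n ;
  Waff : set W ;
  Lambda : set W ;
  act1 : act 1%g = id ;
  actM : forall x y : W, act (x * y)%g = act x \o act y ;
  Waff_bij : set_bij Waff (affine_weyl A) act ;
  Lambda_abelian : forall x y, Lambda x -> Lambda y -> (x * y = y * x)%g ;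
  Lambda_fg : exists s : seq W, Lambda = generated [set` s] ;
  Lambda_transl : exists nu : W -> 'rV[K]_n,
    (forall x y, Lambda x -> Lambda y -> nu (x * y)%g = nu x + nu y) /\
    (forall x v, Lambda x -> act x v = v + nu x) ;
  W_Lambda_W0 : semidirect Lambda (generated (S0_of A act Waff)) ;
  W_Waff_Omega : semidirect Waff (Omega_of A act) }.

Section Length.
Local Open Scope group_scope.
Variables (K : realType) (n : nat) (A : apartment K n) (W : groupType).
Variable D : iwahoriWeyl A W.

Definition Saff : set W := Saff_of A (act D) (Waff D).

(** The component in [Waff], unique since W is [Waff ><| Omega]. *)
Definition aff_part (w : W) : W :=
  xget 1 [set x | Waff D x /\ exists2 y, Omega_of A (act D) y & w = x * y].

Definition ell (w : W) : nat := word_length Saff (aff_part w).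

End Length.

Record is_extension (Z W1 W : groupType) (i : Z -> W1) (p : W1 -> W) : Prop :=
  IsExtension {
    ext_iM : {morph i : x y / (x * y)%g >-> (x * y)%g} ;
    ext_pM : {morph p : x y / (x * y)%g >-> (x * y)%g} ;
    ext_inj : injective i ;
    ext_surj : forall w, exists x, p x = w ;
    ext_exact : forall x, p x = 1%g <-> exists z, i z = x }.

Section Algebra.
Variables (K : realType) (n : nat) (A : apartment K n) (W : groupType).
Variable D : iwahoriWeyl A W.
Variables (Z W1 : groupType) (i : Z -> W1) (p : W1 -> W).
Variable R : comPzRingType.

Definition Saff1 : set W1 := p @^-1` Saff D.

Definition ell1 (w : W1) : nat := ell D (p w).

(** An element of R[Z] is given by its coefficients [{fsfun Z -> R with 0}];
  only the values of [c] on [Saff1] are meaningful. The first condition is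
  c_{st} = c_s t, and the second w(c_s) = c_{w s w^-1}, both compared
  coefficientwise. *)
Record is_parameter (c : W1 -> {fsfun Z -> R with 0}) : Prop := IsParameter {
  par_mul : forall s (t u : Z), Saff1 s -> c (s * i t)%g (u * t)%g = c s u ;
  par_conj : forall (w s : W1) (u u' : Z),
    Saff1 s -> Saff1 (w * s * w^-1)%g ->
    i u' = (w * i u * w^-1)%g -> c (w * s * w^-1)%g u' = c s u }.

Variable c : W1 -> {fsfun Z -> R with 0}.

(** An R-algebra is a ring [H] with a morphism [eta] from R to its center. *)
Variables (H : pzRingType) (eta : {rmorphism R -> H}) (T : W1 -> H).

Definition lincomb (a : {fsfun W1 -> R with 0}) : H :=
  \sum_(w <- finsupp a) eta (a w) * T w.

(** The algebra with parameters (0, c) is characterized up to a unique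
  isomorphism respecting [T]. *)
Record is_hecke : Prop := IsHecke {
  hecke_central : forall (r : R) (x : H), eta r * x = x * eta r ;
  hecke_basis : forall h : H, exists! a : {fsfun W1 -> R with 0}, h = lincomb a ;
  hecke_braid : forall w w' : W1,
    (ell1 w + ell1 w')%N = ell1 (w * w')%g -> T w * T w' = T (w * w')%g ;
  hecke_quad : forall s : W1, Saff1 s ->
    T s * T s = (\sum_(t <- finsupp (c s)) eta (c s t) * T (i t)) * T s }.

Definition supp (h : H) : set W1 :=
  [set w | exists2 a : {fsfun W1 -> R with 0}, h = lincomb a & a w != 0].

Definition supp_max (h : H) : set W1 :=
  [set w | supp h w /\ forall w', supp h w' -> (ell1 w' <= ell1 w)%N].

End Algebra.

Definition in_center (H : pzRingType) (h : H) : Prop := forall x, h * x = x * h.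

(* Main.v *)
Require Import Defs.
From HB Require Import structures.
From mathcomp Require Import all_boot all_order all_algebra.
From mathcomp Require Import monoid finmap.
From mathcomp Require Import boolp classical_sets functions cardinality.
From mathcomp Require Import reals topology normedtype.
From mathcomp Require Import zify ring lra.

Set Implicit Arguments.
Unset Strict Implicit.
Unset Printing Implicit Defensive.

Import Defs.
Import Order.TTheory GRing.Theory Num.Theory.
Import numFieldNormedType.Exports.

Local Open Scope classical_set_scope.
Local Open Scope ring_scope.

(** A subset of W(1) that is finite and stable under conjugation is a finite
  union of finite conjugacy classes, so all the content is that supp(h)_max is
  stable under conjugation ([top_conj_closed]).

  The algebra enters once. The product of T_x and T_w involves the basis
  elements of length l(x) + l(w) exactly as the group does, since a quadratic
  relation only produces shorter terms ([coef_TT]). Comparing the coefficients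
  of T_x h and h T_x at xw therefore shows that w in supp(h)_max and
  l(xw) = l(x) + l(w) put x w x^-1 in supp(h)_max ([top_conj]); the mirror
  statement is [top_conjV]. In particular such conjugates of w all have the
  length of w.

  This forces w to act on the apartment by a translation
  ([bounded_conj_translation]). Indeed choose a vector mu of the coroot lattice
  lying in the same half-spaces as x0 - w x0, where x0 is a point of the base
  alcove. For the translation x by - N mu the lengths of x and w add, for every
  N. The displacement of x0 by x w x^-1 differs from its displacement by w by N
  times a vector that measures how the linear part of w moves mu; as the length
  stays constant, the linear part fixes mu. It also fixes mu + c for every
  coroot c, once mu is taken far enough along the ray of x0 - w x0, hence it
  fixes all coroots, which span.

  For a translation w and a simple reflection s, the wall of s cannot separate
  the base alcove from both its images by w and w^-1, so l(sw) or l(ws) is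
  l(w) + 1 ([ell_translation_mul]) and one of the two conjugation statements
  applies to s. It also applies to elements of length zero, and these together
  with the simple reflections generate W(1).

  The lengths are computed geometrically: l(w) is the number of hyperplanes
  separating x0 from w x0 ([ell_dist]). This rests on galleries: a generic
  segment that leaves an alcove crosses one of its walls first
  ([exists_separating_wall]), and reflecting in a wall changes the number of
  separating hyperplanes by one ([wall_dist_arefl]). *)

(** * Linear algebra of the root system *)

Section PairingTheory.
Variables (K : realType) (n : nat).
Implicit Types (a b f : 'cV[K]_n) (u v x y : 'rV[K]_n).

Lemma pairingD a u v : pairing a (u + v) = pairing a u + pairing a v.
Proof. by rewrite /pairing mulmxDl mxE. Qed.

Lemma pairingZ a t v : pairing a (t *: v) = t * pairing a v.
Proof. by rewrite /pairing -scalemxAl mxE. Qed.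

Lemma pairingN a v : pairing a (- v) = - pairing a v.
Proof. by rewrite -scaleN1r pairingZ mulN1r. Qed.

Lemma pairingB a u v : pairing a (u - v) = pairing a u - pairing a v.
Proof. by rewrite pairingD pairingN. Qed.

Lemma pairing0 a : pairing a 0 = 0.
Proof. by rewrite /pairing mul0mx mxE. Qed.

Lemma pairing_sum a (I : Type) (r : seq I) (F : I -> 'rV[K]_n) :
  pairing a (\sum_(i <- r) F i) = \sum_(i <- r) pairing a (F i).
Proof. by apply: (big_morph _ (pairingD a) (pairing0 a)). Qed.

Lemma pairingDl a b v : pairing (a + b) v = pairing a v + pairing b v.
Proof. by rewrite /pairing mulmxDr mxE. Qed.

Lemma pairingZl t a v : pairing (t *: a) v = t * pairing a v.
Proof. by rewrite /pairing -scalemxAr mxE. Qed.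

Lemma pairingNl a v : pairing (- a) v = - pairing a v.
Proof. by rewrite -scaleN1r pairingZl mulN1r. Qed.

Lemma pairingBl a b v : pairing (a - b) v = pairing a v - pairing b v.
Proof. by rewrite pairingDl pairingNl. Qed.

Lemma pairing0l v : pairing 0 v = 0.
Proof. by rewrite /pairing mulmx0 mxE. Qed.

Lemma pairing_suml v (I : Type) (r : seq I) (F : I -> 'cV[K]_n) :
  pairing (\sum_(i <- r) F i) v = \sum_(i <- r) pairing (F i) v.
Proof.
elim: r => [|i r IH]; first by rewrite !big_nil pairing0l.
by rewrite !big_cons pairingDl IH.
Qed.

Lemma pairing_inj a b : (forall v, pairing a v = pairing b v) -> a = b.
Proof.
move=> h; apply/matrixP => i j; rewrite (ord1 j).
have := h (delta_mx 0 i); rewrite /pairing -!rowE.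
by rewrite !mxE.
Qed.

Lemma pairing_neq0 a : a != 0 -> exists v, pairing a v != 0.
Proof.
move=> a0; apply: contrapT => h; move/negP: a0; apply; apply/eqP.
apply: pairing_inj => v; rewrite pairing0l; apply: contrapT => hv.
by apply: h; exists v; apply/eqP.
Qed.

Lemma pairing_inj_r u v : (forall f, pairing f u = pairing f v) -> u = v.
Proof.
move=> h; apply/matrixP => i j; rewrite (ord1 i).
have := h (delta_mx j 0); rewrite /pairing -!colE.
by rewrite !mxE.
Qed.

End PairingTheory.

(** * Small perturbations *)

Section Near.
Variable K : realType.
Implicit Types (x r : K).

Lemma near_all_seq (T : eqType) (s : seq T) (P : T -> K -> Prop) :
  {in s, forall a, \forall t \near (0 : K)^'+, P a t} ->
  \forall t \near (0 : K)^'+, {in s, forall a, P a t}.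
Proof.
elim: s => [|a s IH] h; first by near=> t.
have h1 : \forall t \near (0 : K)^'+, {in s, forall a, P a t}.
  by apply: IH => b bs; apply: h; rewrite in_cons bs orbT.
have h2 : \forall t \near (0 : K)^'+, P a t by apply: h; rewrite mem_head.
near=> t => b; rewrite in_cons => /orP[/eqP->|bs].
  by near: t.
by move: b bs; near: t.
Unshelve. all: by end_near. Qed.

Lemma near_ltD x y r : x < y -> \forall t \near (0 : K)^'+, x + t * r < y.
Proof.
move=> xy; have [r0|r0] := leP r 0.
  near=> t; have t0 : 0 < t by near: t; exact: nbhs_right_gt.
  by apply: le_lt_trans xy; rewrite gerDl pmulr_rle0.
near=> t; have : t < (y - x) / r.
  by near: t; apply: nbhs_right_lt; rewrite divr_gt0 // subr_gt0.
by rewrite ltr_pdivlMr // ltrBrDl.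
Unshelve. all: by end_near. Qed.

Lemma near_gtD x y r : y < x -> \forall t \near (0 : K)^'+, y < x + t * r.
Proof.
move=> xy; have h : - x < - y by rewrite ltrN2.
apply: filterS (near_ltD (- r) h) => t.
by rewrite mulrN -opprD ltrN2.
Qed.

Lemma near_neq x y r : r != 0 -> \forall t \near (0 : K)^'+, x + t * r != y.
Proof.
move=> r0; have [->|] := eqVneq x y.
  near=> t; have t0 : 0 < t by near: t; exact: nbhs_right_gt.
  by rewrite addrC -subr_eq0 addrK mulf_neq0 // gt_eqF.
rewrite neq_lt => /orP[] h.
  by apply: filterS (near_ltD r h) => t; move=> l; rewrite lt_eqF.
by apply: filterS (near_gtD r h) => t l; rewrite gt_eqF.
Unshelve. all: by end_near. Qed.

Lemma between_ints_neq (m k : int) x :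
  m%:~R < x < (m + 1)%:~R -> x != k%:~R.
Proof.
case/andP=> h1 h2; apply/eqP => e; move: h1 h2; rewrite e !ltr_int => h1 h2.
by rewrite ltzD1 leNgt h1 in h2.
Qed.

Lemma near_nonint x r : r != 0 ->
  \forall t \near (0 : K)^'+, forall k : int, x + t * r != k%:~R.
Proof.
wlog : x r / 0 < r => [hw r0|r0 _].
  have [rp|rn] := ltP 0 r; first exact: hw.
  have h : \forall t \near (0 : K)^'+, forall k : int, - x + t * (- r) != k%:~R.
    by apply: hw; rewrite ?oppr_gt0 ?oppr_eq0 // lt_neqAle r0.
  apply: filterS h => t h k; apply/eqP => e.
  by have /eqP := h (- k); apply; rewrite mulrN -opprD e mulrNz.
have := floor_itv x => /andP[h1 h2].
have h3 := near_ltD r h2.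
near=> t => k; apply: (@between_ints_neq (Num.floor x)).
have t0 : 0 < t by near: t; exact: nbhs_right_gt.
apply/andP; split; last by near: t.
by apply: le_lt_trans h1 _; rewrite ltrDl mulr_gt0.
Unshelve. all: by end_near. Qed.

Lemma seq_argmin (T : eqType) (s : seq T) (f : T -> K) : s != [::] ->
  exists2 a, a \in s & {in s, forall b, f a <= f b}.
Proof.
elim: s => // a s IH _; have [->|/IH[b bs hb]] := eqVneq s [::].
  by exists a; rewrite ?mem_head // => b; rewrite inE => /eqP ->.
have [ab|ba] := leP (f a) (f b).
  exists a; rewrite ?mem_head // => c; rewrite inE => /orP[/eqP->//|/hb].
  exact: le_trans.
exists b; first by rewrite inE bs orbT.
by move=> c; rewrite inE => /orP[/eqP->|/hb//]; exact: ltW.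
Qed.

Lemma right_nbhs_exists (P : K -> Prop) :
  (\forall t \near (0 : K)^'+, P t) -> exists t, P t.
Proof. by move=> h; apply: (@filter_ex _ (0 : K)^'+). Qed.

(** A vector off the kernels of s can be moved slightly along a direction on
  which f does not vanish. *)
Lemma generic_vector n (s : seq 'cV[K]_n) : 0 \notin s ->
  exists v : 'rV[K]_n, {in s, forall f, pairing f v != 0}.
Proof.
elim: s => [|f s IH]; first by exists 0.
rewrite in_cons negb_or eq_sym => /andP[f0 /IH[v hv]].
have [e he] := pairing_neq0 f0.
have [fv|fv] := eqVneq (pairing f v) 0; last first.
  by exists v => g; rewrite in_cons => /orP[/eqP->|/hv].
have h : \forall t \near (0 : K)^'+, {in s, forall g, pairing g (v + t *: e) != 0}.
  apply: near_all_seq => g /hv gv.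
  have [g0|g0] := eqVneq (pairing g e) 0.
    by near=> t; rewrite pairingD pairingZ g0 mulr0 addr0.
  apply: filterS (near_neq (pairing g v) 0 g0) => t.
  by rewrite pairingD pairingZ.
have h' : \forall t \near (0 : K)^'+, 0 < t by exact: nbhs_right_gt.
have [t [h1 h2]] := right_nbhs_exists (filterI h h').
exists (v + t *: e) => g; rewrite in_cons => /orP[/eqP->|/h1//].
by rewrite pairingD pairingZ fv add0r mulf_neq0 // gt_eqF.
Unshelve. all: by end_near. Qed.

End Near.

(** * Roots, coroots and affine symmetries *)

Section Roots.
Variables (K : realType) (n : nat) (Phi : rootSystem K n).
Implicit Types (a b : 'cV[K]_n) (k l : int) (u v x y z : 'rV[K]_n).

Local Notation R := (undup (roots Phi)).

Lemma root_nz a : a \in roots Phi -> a != 0.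
Proof. by move=> ha; apply: contraNneq (root_neq0 Phi) => <-. Qed.

Lemma root_opp a : a \in roots Phi -> - a \in roots Phi.
Proof.
move=> ha; have := root_refl ha ha; rewrite coroot2 //.
by rewrite scaler_nat mulr2n opprD addNKr.
Qed.

Lemma neq_opp_root a : a \in roots Phi -> a != - a.
Proof.
move=> ha; have [v hv] := pairing_neq0 (root_nz ha); apply/eqP => e.
have : pairing a v = pairing (- a) v by rewrite -e.
rewrite pairingNl => e2; have : pairing a v = 0 by lra.
by apply/eqP.
Qed.

Lemma eq_of_pairing_roots u v :
  {in roots Phi, forall a, pairing a u = pairing a v} -> u = v.
Proof.
move=> h; apply: pairing_inj_r => f.
have : f \in <<in_tuple (roots Phi)>>%VS by rewrite root_span memvf.
move/coord_span => ->; rewrite !pairing_suml; apply: eq_bigr => j _.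
by rewrite !pairingZl h // mem_nth.
Qed.

(** The inclusion of kernels makes b a multiple of a, and reducedness leaves
  two multiples. *)
Lemma root_kernel a b : a \in roots Phi -> b \in roots Phi ->
  (forall v, pairing a v = 0 -> pairing b v = 0) -> b = a \/ b = - a.
Proof.
move=> ha hb h.
have e : b = (pairing b (coroot Phi a) / 2) *: a.
  apply: pairing_inj => v; rewrite pairingZl.
  have := h (v - (pairing a v / 2) *: coroot Phi a).
  rewrite !pairingB !pairingZ coroot2 // divfK ?subrr; last by rewrite pnatr_eq0.
  by move=> /(_ erefl) /eqP; rewrite subr_eq0 => /eqP ->; ring.
have := hb; rewrite {1}e => /(root_reduced ha) [] t; rewrite e t.
  by left; rewrite scale1r.
by right; rewrite scaleN1r.
Qed.

Lemma hyperplane_sub_root a k b l : a \in roots Phi -> b \in roots Phi ->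
  hyperplane a k `<=` hyperplane b l -> b = a \/ b = - a.
Proof.
move=> ha hb h; apply: root_kernel => // v av.
pose q := - (k%:~R / 2) *: coroot Phi a.
have hq u : pairing a u = 0 -> hyperplane a k (q + u).
  move=> au; rewrite /hyperplane /affroot /= pairingD pairingZ coroot2 // au.
  by field.
have := h _ (hq _ av); have := h _ (hq 0 (pairing0 a)).
rewrite /hyperplane /affroot /= !pairingD pairing0 => h1 h2; lra.
Qed.

(** Such a map pulls the affine function a + k back to s a + (m a + k); the
  roots being finite in number, it permutes the affine roots and with them the
  hyperplanes. *)
Definition permutes_affroots (f : 'rV[K]_n -> 'rV[K]_n) :=
  exists s : 'cV[K]_n -> 'cV[K]_n, exists m : 'cV[K]_n -> int,
  [/\ {in roots Phi, forall a, s a \in roots Phi},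
      {in roots Phi &, injective s} &
      {in roots Phi, forall a v, pairing a (f v) = pairing (s a) v + (m a)%:~R}].

Lemma permutes_affroots_id : permutes_affroots id.
Proof. by exists id, (fun=> 0); split => // a _ v; rewrite addr0. Qed.

Lemma permutes_affroots_comp f g :
  permutes_affroots f -> permutes_affroots g -> permutes_affroots (f \o g).
Proof.
move=> [s [m [s1 s2 s3]]] [s' [m' [s1' s2' s3']]].
exists (s' \o s), (fun a => m' (s a) + m a); split.
- by move=> a ha /=; apply/s1'/s1.
- by move=> a b ha hb /= e; apply: s2 => //; apply: s2' => //; apply: s1.
- by move=> a ha v /=; rewrite s3 // s3' ?s1 // rmorphD addrA.
Qed.

Lemma permutes_affroots_arefl a k :
  a \in roots Phi -> permutes_affroots (arefl Phi a k).
Proof.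
move=> ha; pose s b := b - pairing b (coroot Phi a) *: a.
exists s, (fun b => - k * Num.floor (pairing b (coroot Phi a))); split.
- by move=> b hb; apply: root_refl.
- have ss b : s (s b) = b.
    rewrite /s pairingBl pairingZl coroot2 // mulr_natr mulr2n opprD addNKr.
    by rewrite scaleNr opprK subrK.
  by move=> b c _ _ /(congr1 s); rewrite !ss.
- move=> b hb v; have [z hz] := root_integral ha hb.
  have [z' hz'] := root_integral hb ha.
  rewrite /arefl /affroot pairingB pairingZ pairingBl pairingZl.
  by rewrite hz intrKfloor rmorphM rmorphN; ring.
Qed.

Lemma permutes_affroots_weyl f : affine_weyl Phi f -> permutes_affroots f.
Proof.
case=> s + ->; elim: s => [|p s IH] h; first exact: permutes_affroots_id.
apply: permutes_affroots_comp; last by apply: IH => q qs; apply: h; rewrite in_cons qs orbT.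
by apply: permutes_affroots_arefl; apply: h; rewrite mem_head.
Qed.

Lemma permuted_roots_perm s : {in roots Phi, forall a, s a \in roots Phi} ->
  {in roots Phi &, injective s} -> perm_eq (map s R) R.
Proof.
move=> s1 s2.
have u : uniq (map s R).
  rewrite map_inj_in_uniq ?undup_uniq // => a b.
  by rewrite !mem_undup; apply: s2.
apply: uniq_perm (undup_uniq _) _ => //.
have [] // := @uniq_min_size _ (map s R) R u _ _; last by rewrite size_map.
by move=> _ /mapP[a ha ->]; rewrite mem_undup s1 // -mem_undup.
Qed.

(** The invariant inner product on V; it identifies the coroot of a with a
  positive multiple of a. *)
Definition root_form u v : K := \sum_(b <- R) pairing b u * pairing b v.

Lemma root_formZl t u v : root_form (t *: u) v = t * root_form u v.
Proof. by rewrite mulr_sumr; apply: eq_bigr => b _; rewrite pairingZ mulrA. Qed.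

Lemma root_formDl u u' v : root_form (u + u') v = root_form u v + root_form u' v.
Proof. by rewrite -big_split; apply: eq_bigr => b _; rewrite pairingD mulrDl. Qed.

Lemma root_formC u v : root_form u v = root_form v u.
Proof. by apply: eq_bigr => b _; rewrite mulrC. Qed.

Lemma root_form_ge0 v : 0 <= root_form v v.
Proof. by apply: sumr_ge0 => b _; rewrite -expr2 sqr_ge0. Qed.

Lemma root_form_eq0 v :
  root_form v v = 0 -> {in roots Phi, forall a, pairing a v = 0}.
Proof.
move=> h a ha; have /eqP := h; rewrite psumr_eq0; last first.
  by move=> b _; rewrite -expr2 sqr_ge0.
move=> /allP /(_ a); rewrite mem_undup => /(_ ha) /=.
by rewrite -expr2 sqrf_eq0 => /eqP.
Qed.

Lemma root_form_coroot_gt0 a : a \in roots Phi ->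
  0 < root_form (coroot Phi a) (coroot Phi a).
Proof.
move=> ha; rewrite lt_def root_form_ge0 andbT; apply/eqP => /root_form_eq0.
by move=> /(_ a ha)/eqP; rewrite coroot2 // pnatr_eq0.
Qed.

(** The reflection of a preserves the form and negates the coroot. *)
Lemma root_form_coroot a v : a \in roots Phi ->
  root_form (coroot Phi a) v =
  root_form (coroot Phi a) (coroot Phi a) / 2 * pairing a v.
Proof.
move=> ha; have [s [m [s1 s2 s3]]] := permutes_affroots_arefl 0 ha.
have lin b u : b \in roots Phi ->
    pairing b (arefl Phi a 0 u) = pairing (s b) u.
  move=> hb; rewrite s3 //; have := s3 b hb 0.
  rewrite /arefl /affroot !pairing0 addr0 scale0r subr0 pairing0 add0r => <-.
  by rewrite addr0.
have inv u w : root_form (arefl Phi a 0 u) (arefl Phi a 0 w) = root_form u w.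
  rewrite /root_form -[in RHS](perm_big _ (permuted_roots_perm s1 s2)) /= big_map.
  by rewrite big_seq [RHS]big_seq; apply: eq_bigr => b; rewrite mem_undup => hb; rewrite !lin.
have refl u : arefl Phi a 0 u = u - pairing a u *: coroot Phi a.
  by rewrite /arefl /affroot addr0.
have := inv (coroot Phi a) v; rewrite !refl coroot2 //.
rewrite scaler_nat mulr2n opprD addNKr -scaleN1r root_formZl root_formC.
rewrite -scaleNr root_formDl root_formZl (root_formC v).
by move=> e; lra.
Qed.

(** The vector v and the combination with coefficients a(v) / c_a, where c_a
  turns a into its coroot, have the same products with all vectors. *)
Lemma coroots_span v : exists r : 'cV[K]_n -> K,
  v = \sum_(a <- R) r a *: coroot Phi a.
Proof.
pose c a := root_form (coroot Phi a) (coroot Phi a) / 2.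
exists (fun a => pairing a v / c a).
set w := \sum_(a <- R) _.
have hw u : root_form w u = root_form v u.
  rewrite /w (big_morph (root_form^~ u) (id1 := 0) (op1 := +%R)); last first.
  - by rewrite /root_form big1 // => b _; rewrite pairing0 mul0r.
  - by move=> x y; exact: root_formDl.
  rewrite big_seq [RHS]big_seq; apply: eq_bigr => a; rewrite mem_undup => ha.
  rewrite root_formZl root_form_coroot // -/(c a) mulrA divfK //.
  by rewrite gt_eqF // divr_gt0 // root_form_coroot_gt0.
have : root_form (v - w) (v - w) = 0.
  rewrite root_formDl -[- w]scaleN1r root_formZl hw; lra.
move/root_form_eq0 => h; apply: eq_of_pairing_roots => a ha.
by apply/eqP; rewrite -subr_eq0 -pairingB; apply/eqP/h.
Qed.

Lemma eq_of_pairing_coroots a b :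
  {in roots Phi, forall c, pairing a (coroot Phi c) = pairing b (coroot Phi c)} ->
  a = b.
Proof.
move=> h; apply: pairing_inj => v; have [r ->] := coroots_span v.
rewrite !pairing_sum !big_seq; apply: eq_bigr => c; rewrite mem_undup => hc.
by rewrite !pairingZ h.
Qed.

End Roots.

(** * Alcoves, walls and galleries *)

Section Alcoves.
Variables (K : realType) (n : nat) (Phi : rootSystem K n).
Implicit Types (a b c : 'cV[K]_n) (k l : int) (u v x y z : 'rV[K]_n).

Local Notation R := (undup (roots Phi)).

Definition off_walls x :=
  {in roots Phi, forall a k, pairing a x != k%:~R}.

Definition level a x : int := Num.floor (pairing a x).

(** Twice the number of hyperplanes separating x and y, since each of them is
  counted for a root and for its opposite. *)
Definition wall_dist x y : nat :=
  (\sum_(a <- R) absz (level a x - level a y)%R)%N.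

Lemma wall_dist_sym x y : wall_dist x y = wall_dist y x.
Proof. by apply: eq_bigr => a _; rewrite -abszN opprB. Qed.

Lemma wall_dist_triangle y x z :
  (wall_dist x z <= wall_dist x y + wall_dist y z)%N.
Proof. by rewrite -big_split /=; apply: leq_sum => a _; lia. Qed.

Lemma wall_dist_eq0 x y :
  (wall_dist x y = 0)%N <-> {in roots Phi, forall a, level a x = level a y}.
Proof.
split=> [/eqP|h]; last first.
  rewrite /wall_dist big_seq big1 // => a; rewrite mem_undup => ha.
  by rewrite h // subrr.
rewrite sum_nat_seq_eq0 => /allP h a ha; have := h a.
by rewrite mem_undup => /(_ ha) /=; lia.
Qed.

Lemma level_permuted f s m :
  {in roots Phi, forall a v, pairing a (f v) = pairing (s a) v + (m a)%:~R} ->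
  {in roots Phi, forall a x, level a (f x) = level (s a) x + m a}.
Proof. by move=> h a ha x; rewrite /level h // floorDrz ?intr_int // intrKfloor. Qed.

Lemma wall_dist_permutes f x y : permutes_affroots Phi f ->
  wall_dist (f x) (f y) = wall_dist x y.
Proof.
move=> [s [m [s1 s2 s3]]]; have hl := level_permuted s3.
rewrite /wall_dist -[in RHS](perm_big _ (permuted_roots_perm s1 s2)) /= big_map.
rewrite big_seq [RHS]big_seq; apply: eq_bigr => a; rewrite mem_undup => ha.
by rewrite !hl // opprD addrACA subrr addr0.
Qed.

Lemma off_walls_permutes f x : permutes_affroots Phi f ->
  off_walls x -> off_walls (f x).
Proof.
move=> [s [m [s1 s2 s3]]] hx a ha k; rewrite s3 // -subr_eq0 -addrA -rmorphB /=.
by rewrite -[_ - k]opprB rmorphN /= subr_eq0; apply: hx; apply: s1.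
Qed.

Lemma off_walls_bounds a x : a \in roots Phi -> off_walls x ->
  (level a x)%:~R < pairing a x < (level a x)%:~R + 1.
Proof.
move=> ha hx; have /andP[h1 h2] := floor_itv (pairing a x).
by rewrite lt_neqAle eq_sym hx //= h1 /=; rewrite rmorphD in h2.
Qed.

Lemma levelN a x : a \in roots Phi -> off_walls x ->
  level (- a) x = - level a x - 1.
Proof.
move=> ha hx; have /andP[h1 h2] := off_walls_bounds ha hx.
apply: floor_def; rewrite pairingNl subrK !rmorphB rmorphN /=.
by apply/andP; split; lra.
Qed.

Lemma facetP x y : off_walls x -> facet Phi x y <->
  off_walls y /\ {in roots Phi, forall a, level a y = level a x}.
Proof.
move=> hx; split=> [h|[hy h] a ha k]; last first.
  have := off_walls_bounds ha hx; have := off_walls_bounds ha hy.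
  rewrite h // /affroot => /andP[y1 y2] /andP[x1 x2].
  have [hk|hk] := leP (- k) (level a x).
    have : (- k)%:~R <= (level a x)%:~R :> K by rewrite ler_int.
    by rewrite rmorphN /= => hk'; rewrite !gtr0_sg //; lra.
  have : (level a x)%:~R + 1 <= (- k)%:~R :> K.
    by rewrite -[1]/(1%:~R) -rmorphD ler_int; lia.
  by rewrite rmorphN /= => hk'; rewrite !ltr0_sg //; lra.
have hy : off_walls y.
  move=> a ha k; apply/eqP => e; have := h a ha (- k).
  rewrite /affroot e rmorphN /= subrr sgr0 => /esym/eqP.
  by rewrite sgr_eq0 subr_eq0; apply/negP/hx.
split=> // a ha; have /andP[x1 x2] := off_walls_bounds ha hx.
apply: floor_def; rewrite rmorphD /=.
have := h a ha (- (level a x + 1)).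
rewrite /affroot rmorphN rmorphD /= [RHS]ltr0_sg; last by lra.
move=> /eqP; rewrite sgr_cp0 => h1; have := h a ha (- level a x).
rewrite /affroot rmorphN /= [RHS]gtr0_sg; last by lra.
move=> /eqP; rewrite sgr_cp0 => h2.
by apply/andP; split; lra.
Qed.

Lemma facet_refl x : facet Phi x x.
Proof. by []. Qed.

Lemma pairing_continuous a : continuous (pairing a : 'rV[K]_n -> K).
Proof.
have -> : pairing a = fun w : 'rV[K]_n => \sum_j w 0 j * a j 0.
  by apply/funext => w; rewrite /pairing mxE.
apply: continuous_big => [|j _ v]; first exact: add_continuous.
apply: continuousM; last exact: cst_continuous.
exact: (@coord_continuous K 1 n 0 j v).
Qed.

(** The upper bounds on the levels come from the opposite roots. For the
  converse, z is approached along the segment from x, which stays in the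
  facet. *)
Lemma closure_facet x z : off_walls x ->
  closure (facet Phi x) z <->
  {in roots Phi, forall a, (level a x)%:~R <= pairing a z}.
Proof.
move=> hx; split=> [h a ha|h].
  have hc : closed [set v : 'rV[K]_n | (level a x)%:~R <= pairing a v].
    apply: (@preimage_closed _ _ (pairing a) [set t | (level a x)%:~R <= t]).
      by move=> v _; exact: pairing_continuous.
    exact: closed_ge.
  move/closure_id: hc => hc.
  have : closure [set v : 'rV[K]_n | (level a x)%:~R <= pairing a v] z.
    apply: closureS h => y /(facetP _ hx)[hy hl] /=; rewrite -hl //.
    by have /andP[/ltW] := off_walls_bounds ha hy.
  by rewrite -hc.
move=> B zB.
have cv : (z + t *: (x - z)) @[t --> (0 : K)^'+] --> z.
  rewrite -[X in _ --> X]addr0 -(scale0r (x - z)).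
  apply: cvgD; first exact: cvg_cst.
  apply: cvgZr_tmp; apply: cvg_at_right_filter; exact: cvg_id.
have h1 : \forall t \near (0 : K)^'+, B (z + t *: (x - z)) by apply: cv.
have h2 : \forall t \near (0 : K)^'+, 0 < t by exact: nbhs_right_gt.
have h3 : \forall t \near (0 : K)^'+, t < 1 by exact: nbhs_right_lt.
have [t [Bt [t0 t1]]] := right_nbhs_exists (filterI h1 (filterI h2 h3)).
exists (z + t *: (x - z)); split=> //.
have low b : b \in roots Phi ->
    (level b x)%:~R < pairing b (z + t *: (x - z)).
  move=> hb; have := h b hb; have /andP[x1 _] := off_walls_bounds hb hx.
  by rewrite pairingD pairingZ pairingB => z1; nra.
have up b : b \in roots Phi ->
    pairing b (z + t *: (x - z)) < (level b x + 1)%:~R.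
  move=> hb; have := low _ (root_opp hb); rewrite levelN // rmorphB rmorphN rmorphD /=.
  by rewrite pairingNl => ?; lra.
apply/facetP => //; split=> a ha.
  by move=> k; apply: (@between_ints_neq _ (level a x)); rewrite low // up.
by apply: floor_def; rewrite up // ltW ?low.
Qed.

(** The facet that spans a wall lies on no hyperplane but that one, since
  distinct hyperplanes are not contained in one another. This is the form in
  which walls are used. *)
Lemma wall_point x a k : off_walls x -> is_wall Phi (facet Phi x) a k ->
  exists z, [/\ affroot a k z = 0,
    {in roots Phi, forall b, b != a -> b != - a -> forall l, pairing b z != l%:~R} &
    {in roots Phi, forall b, (level b x)%:~R <= pairing b z}].
Proof.
move=> hx [ha [z hz hs]]; exists z.
have az : hyperplane a k z.
  rewrite -hs => b hb l; apply; exact: facet_refl.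
split=> //; last by apply/closure_facet => //; apply: hz; exact: facet_refl.
move=> b hb ba bNa l; apply/eqP => e.
have [] // := @hyperplane_sub_root _ _ Phi a k b (- l) ha hb _; last 2 first.
- by move/eqP; rewrite (negPf ba).
- by move/eqP; rewrite (negPf bNa).
rewrite -hs => v; apply=> // y hy; rewrite /hyperplane /=.
have := hy b hb (- l); rewrite {2}/affroot e rmorphN /= subrr sgr0.
by move/eqP; rewrite sgr_eq0 => /eqP.
Qed.

Lemma affroot_arefl a k x : a \in roots Phi ->
  affroot a k (arefl Phi a k x) = - affroot a k x.
Proof.
move=> ha; rewrite /arefl {1}/affroot pairingB pairingZ coroot2 // /affroot.
by ring.
Qed.

Lemma areflK a k : a \in roots Phi -> involutive (arefl Phi a k).
Proof.
move=> ha x; rewrite {1}/arefl affroot_arefl // scaleNr opprK.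
by rewrite /arefl subrK.
Qed.

Lemma level_wall x a k : off_walls x -> is_wall Phi (facet Phi x) a k ->
  level a x = - k \/ level a x = - k - 1.
Proof.
move=> hx hw; have [z [az _ zx]] := wall_point hx hw; have [ha _] := hw.
have z1 := zx a ha; have := zx _ (root_opp ha).
have /andP[x1 x2] := off_walls_bounds ha hx.
rewrite pairingNl levelN // rmorphB rmorphN /= => z2.
rewrite /affroot in az.
have : (level a x)%:~R <= (- k)%:~R :> K by rewrite rmorphN /=; lra.
have : (- k)%:~R <= (level a x + 1)%:~R :> K by rewrite rmorphD rmorphN /=; lra.
by rewrite !ler_int; lia.
Qed.

Lemma level_arefl_wall x a k : off_walls x -> is_wall Phi (facet Phi x) a k ->
  level a (arefl Phi a k x) = - 2 * k - 1 - level a x.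
Proof.
move=> hx [ha _]; have /andP[x1 x2] := off_walls_bounds ha hx.
have := affroot_arefl k x ha; rewrite /affroot => e.
by apply: floor_def; rewrite !rmorphD !rmorphN !rmorphM rmorphN /=; lra.
Qed.

(** At a point z of the wall that lies on no other hyperplane, the level of b is
  locally constant; both x and its reflection are adjacent to z. *)
Lemma level_arefl_other x a k : off_walls x -> is_wall Phi (facet Phi x) a k ->
  {in roots Phi, forall b, b != a -> b != - a ->
     level b (arefl Phi a k x) = level b x}.
Proof.
move=> hx hw b hb ba bNa; have [z [az zb zx]] := wall_point hx hw.
have [ha _] := hw.
have [s [m [s1 s2 s3]]] := permutes_affroots_arefl k ha.
have lz c : c \in roots Phi -> c != a -> c != - a -> level c x = level c z.
  move=> hc ca cNa; apply/esym; apply: floor_def; rewrite zx //=.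
  have := zx _ (root_opp hc); rewrite pairingNl levelN // rmorphB rmorphN /=.
  by rewrite lt_neqAle zb //= rmorphD /= => ?; lra.
have sz : arefl Phi a k z = z by rewrite /arefl az scale0r subr0.
have sb c : c \in roots Phi -> s c = a \/ s c = - a -> c = a \/ c = - a.
  move=> hc hsc; apply: (root_kernel (Phi := Phi)) => // v av.
  have s0 w : pairing a w = 0 -> pairing (s c) w = 0.
    by case: hsc => ->; rewrite ?pairingNl => ->; rewrite ?oppr0.
  have := s3 c hc (z + v); have := s3 c hc z.
  rewrite sz pairingD (s0 v av) addr0 => <-.
  rewrite /arefl; have -> : affroot a k (z + v) = 0.
    by rewrite /affroot pairingD av addr0.
  by rewrite scale0r subr0 pairingD => e; lra.
rewrite (level_permuted s3) // lz; last 3 first.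
- exact: s1.
- by apply/eqP => /or_introl /(sb b hb)[] e; [move: ba | move: bNa]; rewrite e eqxx.
- by apply/eqP => /or_intror /(sb b hb)[] e; [move: ba | move: bNa]; rewrite e eqxx.
by rewrite -(level_permuted s3) // sz -lz.
Qed.

(** Reflecting x in a wall of its alcove changes the levels of only two
  roots, a and its opposite, by one each. *)
Lemma wall_dist_arefl x y a k : off_walls x -> off_walls y ->
  is_wall Phi (facet Phi x) a k ->
  (wall_dist (arefl Phi a k x) y + 2 * absz (level a x - level a y)%R =
   wall_dist x y + 2 * absz (- 2 * k - 1 - level a x - level a y)%R)%N.
Proof.
move=> hx hy hw; have [ha _] := hw; have hNa := root_opp ha.
have split w : wall_dist w y = (absz (level a w - level a y)%R +
    (absz (level (- a) w - level (- a) y)%R +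
     \sum_(b <- R | (b != a) && (b != - a)) absz (level b w - level b y)%R))%N.
  rewrite /wall_dist (bigD1_seq a) ?undup_uniq ?mem_undup //=; congr addn.
  rewrite -big_filter (bigD1_seq (- a)) ?filter_uniq ?undup_uniq //=; last first.
    by rewrite mem_filter mem_undup hNa eq_sym (neq_opp_root ha).
  by congr addn; rewrite big_filter_cond.
have hs : off_walls (arefl Phi a k x).
  exact: off_walls_permutes (permutes_affroots_arefl k ha) hx.
rewrite !split !levelN // !level_arefl_wall //.
have -> : (\sum_(b <- R | (b != a) && (b != - a))
    absz (level b (arefl Phi a k x) - level b y)%R =
  \sum_(b <- R | (b != a) && (b != - a)) absz (level b x - level b y)%R)%N.
  rewrite big_seq_cond [RHS]big_seq_cond; apply: eq_bigr => b.
  rewrite mem_undup => /and3P[hb ba bNa].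
  by rewrite level_arefl_other.
lia.
Qed.

(** On the segment from x' to y, the root b reaches the value level b x + 1 at
  the time (level b x + 1 - b(x')) / (b(y) - b(x')). The coincidence of the
  times of two roots, cross-multiplied, is an affine equation on x', as the
  quadratic terms cancel. It is nontrivial since b and c are not proportional,
  so a small displacement x' of x avoids all these equations. *)
Lemma generic_crossings x y : off_walls x -> off_walls y ->
  exists x', facet Phi x x' /\
  {in roots Phi &, forall b c, b != c ->
     level b x < level b y -> level c x < level c y ->
     ((level b x)%:~R + 1 - pairing b x') * (pairing c y - pairing c x') !=
     ((level c x)%:~R + 1 - pairing c x') * (pairing b y - pairing b x')}.
Proof.
move=> hx hy; pose N b : K := (level b x)%:~R + 1.
pose up b := level b x < level b y.
(* The linear part of the equation for b and c. *)
pose g b c := (N c - pairing c y) *: b - (N b - pairing b y) *: c.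
have upN b : b \in roots Phi -> up b -> N b < pairing b y.
  move=> hb; rewrite /up -lezD1 -(ler_int K) rmorphD /= /N.
  by have /andP[] := off_walls_bounds hb hy => ? _ ?; lra.
pose L := [seq g p.1 p.2 | p <- [seq (b, c) | b <- [seq b <- R | up b],
                                   c <- [seq c <- R | up c]] & p.1 != p.2].
have memL b c : b \in roots Phi -> c \in roots Phi -> b != c -> up b -> up c ->
    g b c \in L.
  move=> hb hc bc ub uc; apply/mapP; exists (b, c) => //.
  by rewrite mem_filter bc; apply/allpairsP; exists (b, c); rewrite !mem_filter !mem_undup ub uc hb hc.
have [u hu] : exists u : 'rV[K]_n, {in L, forall f, pairing f u != 0}.
  apply: generic_vector; apply/mapP => -[[b c]].
  rewrite mem_filter => /andP[/= bc /allpairsP[[b' c'] /=]].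
  rewrite !mem_filter !mem_undup => -[/andP[ub hb] /andP[uc hc] [eb ec]].
  rewrite -{}eb -{}ec in ub hb uc hc => /esym g0.
  have [e|e] : b = c \/ b = - c.
    apply: (root_kernel (Phi := Phi) hc hb) => v cv.
    have := congr1 (fun f => pairing f v) g0.
    rewrite /g pairingBl !pairingZl cv mulr0 subr0 pairing0l => /eqP.
    rewrite mulf_eq0 => /orP[/eqP e|/eqP//].
    by have := upN c hc uc; lra.
  - by rewrite e eqxx in bc.
  - by move: ub; rewrite /up e !levelN //; move: uc; rewrite /up; lia.
have near_facet : \forall t \near (0 : K)^'+, facet Phi x (x + t *: u).
  have h : \forall t \near (0 : K)^'+, {in roots Phi, forall b,
      (level b x)%:~R < pairing b (x + t *: u) < (level b x + 1)%:~R}.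
    apply: near_all_seq => b hb; have /andP[x1 x2] := off_walls_bounds hb hx.
    have n1 := near_gtD (pairing b u) x1; have n2 := near_ltD (pairing b u) x2.
    apply: filterS (filterI n1 n2) => t [h1 h2].
    by rewrite pairingD pairingZ rmorphD /= h1 h2.
  apply: filterS h => t h; apply/facetP => //; split=> b hb.
    by move=> k; apply: (@between_ints_neq _ (level b x)); exact: h.
  by apply: floor_def; have /andP[/ltW -> ->] := h b hb.
have near_gen : \forall t \near (0 : K)^'+, {in R, forall b, {in R, forall c,
    b != c -> up b -> up c -> pairing (g b c) x + t * pairing (g b c) u !=
      N c * pairing b y - N b * pairing c y}}.
  apply: near_all_seq => b; rewrite mem_undup => hb.
  apply: near_all_seq => c; rewrite mem_undup => hc.
  have [bc|bc] := eqVneq b c; first by apply: nearW => t.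
  have [ub|ub] := boolP (up b); last by apply: nearW => t.
  have [uc|uc] := boolP (up c); last by apply: nearW => t.
  have gu := hu _ (memL b c hb hc bc ub uc).
  have := near_neq (pairing (g b c) x) (N c * pairing b y - N b * pairing c y) gu.
  by apply: filterS => t h _ _ _.
have [t [h1 h2]] := right_nbhs_exists (filterI near_facet near_gen).
exists (x + t *: u); split=> // b c hb hc bc ub uc.
have := h2 b; rewrite mem_undup => /(_ hb c); rewrite mem_undup => /(_ hc bc ub uc).
apply: contraNneq; rewrite -pairingZ -pairingD /g pairingBl !pairingZl -/(N b) -/(N c).
by move=> e; apply/eqP; nra.
Qed.

(** A segment to y from a generic point x' of the alcove of x meets the
  hyperplanes one at a time. The first point z where it meets one is in the
  closure of the alcove and on no other hyperplane, so this one is a wall. *)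
Lemma exists_separating_wall x y : off_walls x -> off_walls y ->
  wall_dist x y != 0%N ->
  exists a k, [/\ is_wall Phi (facet Phi x) a k,
                  level a x = - k - 1 & - k <= level a y].
Proof.
move=> hx hy hd; have [x' [xx' hgen]] := generic_crossings hx hy.
have [hx' lx'] := (facetP x' hx).1 xx'.
(* Upward crossings suffice: a downward crossing of b is an upward crossing of
  its opposite. *)
pose up b := level b x < level b y.
pose time b : K := ((level b x)%:~R + 1 - pairing b x') / (pairing b y - pairing b x').
pose B := [seq b <- R | up b].
have bx b (hb : b \in roots Phi) := off_walls_bounds hb hx'.
have bY b (hb : b \in roots Phi) := off_walls_bounds hb hy.
have upN b : b \in roots Phi -> up b -> (level b x)%:~R + 1 < pairing b y.
  move=> hb; rewrite /up -lezD1 -(ler_int K) rmorphD /=.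
  by have /andP[] := bY b hb => ? _ ?; lra.
have B0 : B != [::].
  apply: contraNneq hd => B0; apply/eqP/wall_dist_eq0 => b hb.
  have nup c : c \in roots Phi -> ~~ up c.
    move=> hc; apply/negP => uc; suff : c \in B by rewrite B0.
    by rewrite mem_filter mem_undup uc.
  have := nup _ (root_opp hb); have := nup _ hb; rewrite /up !levelN //; lia.
have [a] := seq_argmin time B0; rewrite mem_filter mem_undup => /andP[ua ha] amin.
have gap b : b \in roots Phi -> up b -> 0 < pairing b y - pairing b x'.
  by move=> hb /(upN b hb); have := bx b hb; rewrite lx' // => /andP[_ ?] ?; lra.
have later b : b \in roots Phi -> up b -> b != a -> time a < time b.
  move=> hb ub ba; rewrite lt_neqAle amin; last by rewrite mem_filter mem_undup ub hb.
  have [ga gb] := (gap a ha ua, gap b hb ub).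
  rewrite andbT /time eqr_div; [|by rewrite gt_eqF..].
  by apply: (hgen a b ha hb _ ua ub); rewrite eq_sym.
set T := time a; pose z := x' + T *: (y - x').
have zE b : pairing b z = pairing b x' + T * (pairing b y - pairing b x').
  by rewrite pairingD pairingZ pairingB.
have T0 : 0 < T.
  apply: divr_gt0; last exact: gap.
  by have := bx a ha; rewrite lx' // => /andP[_ ?]; lra.
have T1 : T < 1 by rewrite /T ltr_pdivrMr ?gap // mul1r; have := upN a ha ua; lra.
have za : pairing a z = (level a x)%:~R + 1.
  by rewrite zE /T /time divfK ?gt_eqF ?gap //; ring.
have upz b : b \in roots Phi -> up b -> b != a ->
    (level b x)%:~R < pairing b z < (level b x)%:~R + 1.
  move=> hb ub ba; rewrite zE; have := later b hb ub ba; have := gap b hb ub.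
  have := bx b hb; rewrite lx' // => /andP[x1 x2] g0.
  rewrite -/T [time b]/time ltr_pdivlMr // => lt.
  have : 0 < T * (pairing b y - pairing b x') by rewrite mulr_gt0.
  by move=> pos; apply/andP; split; lra.
have nupz b : b \in roots Phi -> b != a -> b != - a ->
    (level b x)%:~R < pairing b z < (level b x)%:~R + 1.
  move=> hb ba bNa; have [ub|nu] := boolP (up b); first exact: upz.
  have [uNb|nuN] := boolP (up (- b)).
    have := upz _ (root_opp hb) uNb; rewrite eqr_oppLR => /(_ bNa).
    rewrite pairingNl levelN // rmorphB rmorphN /= => /andP[z1 z2].
    by apply/andP; split; lra.
  have e : level b x = level b y.
    by move: nu nuN; rewrite /up !levelN //; lia.
  have := bx b hb; have := bY b hb; rewrite lx' // -e zE => /andP[y1 y2] /andP[x1 x2].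
  by apply/andP; split; nra.
have only b l : b \in roots Phi -> pairing b z = l%:~R -> b = a \/ b = - a.
  move=> hb e; have [->|ba] := eqVneq b a; first by left.
  have [->|bNa] := eqVneq b (- a); first by right.
  have := nupz b hb ba bNa; rewrite -[1]/(1%:~R) -rmorphD => /between_ints_neq.
  by move=> /(_ l)/eqP.
have zx b : b \in roots Phi -> (level b x)%:~R <= pairing b z.
  move=> hb; have [->|ba] := eqVneq b a; first by rewrite za lerDl.
  have [->|bNa] := eqVneq b (- a).
    by rewrite levelN // pairingNl za rmorphB rmorphN /=; lra.
  by have /andP[/ltW] := nupz b hb ba bNa.
pose k := - (level a x + 1).
have zk : affroot a k z = 0.
  by rewrite /affroot za /k rmorphN rmorphD /= subrr.
exists a, k; split; [|rewrite /k; lia|by move: ua; rewrite /up /k; lia].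
split=> //; exists z.
  move=> w hw; apply/closure_facet => // b hb.
  have := hw b hb (- level b x); rewrite /affroot rmorphN /= => e.
  rewrite -subr_ge0 -sgr_ge0 e sgr_ge0 subr_ge0; exact: zx.
apply/seteqP; split=> v.
  apply=> // w hw; have := hw a ha k; rewrite zk sgr0 => /eqP.
  by rewrite sgr_eq0 => /eqP.
move=> hv b hb l hl; have /eqP := hl z (facet_refl z).
rewrite addr_eq0 -rmorphN => /eqP e; have [eb|eb] := only b (- l) hb e.
  rewrite eb in e *; have -> : l = k; last exact: hv.
  by have : (- l)%:~R = (- k)%:~R :> K; [rewrite -e za /k opprK rmorphD | move/intr_inj/oppr_inj].
rewrite eb in e *; have -> : l = - k.
  have : (- l)%:~R = k%:~R :> K; last by move/intr_inj => <-; rewrite opprK.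
  by rewrite -e pairingNl za /k rmorphN rmorphD.
have := hv; rewrite /hyperplane /affroot /= pairingNl mulrNz => hv'.
by rewrite -opprD hv' oppr0.
Qed.

(** Distances decrease by reflecting, so every generic point is brought into
  the alcove of x by a product of reflections in its walls. *)
Lemma gallery x y : off_walls x -> off_walls y ->
  exists s : seq ('cV[K]_n * int),
  [/\ {in s, forall p, is_wall Phi (facet Phi x) p.1 p.2},
      wall_dist x y = (2 * size s)%N &
      facet Phi x (foldl (fun v p => arefl Phi p.1 p.2 v) y s)].
Proof.
move=> hx; have [m] := ubnP (wall_dist x y).
elim: m => // m IH in y * => hm hy.
have [d0|d0] := eqVneq (wall_dist x y) 0%N.
  exists [::]; split=> //; apply/facetP => //; split=> // a ha.
  by have /wall_dist_eq0 -> := d0.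
have [a [k [hw ax ay]]] := exists_separating_wall hx hy d0; have [ha _] := hw.
have := wall_dist_arefl hx hy hw; rewrite ax => e.
have e' : wall_dist x (arefl Phi a k y) = wall_dist (arefl Phi a k x) y.
  rewrite -(wall_dist_permutes _ _ (permutes_affroots_arefl k ha)) areflK //.
rewrite -e' in e.
have [||s [s1 s2 s3]] := IH (arefl Phi a k y); first by lia.
  exact: off_walls_permutes (permutes_affroots_arefl k ha) hy.
exists ((a, k) :: s); split=> //; last by rewrite /=; lia.
by move=> p; rewrite in_cons => /orP[/eqP->|/s1].
Qed.

End Alcoves.

(** * The length function of the Iwahori-Weyl group *)

Section IwahoriWeylLength.
Variables (K : realType) (n : nat) (A : apartment K n) (W : groupType).
Variable D : iwahoriWeyl A W.
Variable x0 : 'rV[K]_n.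
Hypothesis x0_off : off_walls A x0.
Hypothesis A0_facet : A0 A = facet A x0.
Implicit Types (a b : 'cV[K]_n) (k : int) (v y : 'rV[K]_n) (w x s : W).

Local Notation action := (act D).
Local Notation dist := (wall_dist A).

Section Subgroup.
Local Open Scope group_scope.
Variables (G : groupType) (H : set G).
Hypothesis subH : is_subgroup H.

Lemma subgroup1 : H 1. Proof. by case: subH. Qed.

Lemma subgroupV (x : G) : H x -> H x^-1.
Proof. by case: subH => h1 hM hx; have := hM _ _ h1 hx; rewrite mul1g. Qed.

Lemma subgroupM (x y : G) : H x -> H y -> H (x * y).
Proof.
move=> hx hy; have := subH.2 _ _ hx (subgroupV hy).
by rewrite invgK.
Qed.

End Subgroup.

Lemma actMv w x v : action (w * x)%g v = action w (action x v).
Proof. by rewrite actM. Qed.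

Lemma actK w : cancel (action w) (action w^-1%g).
Proof. by move=> v; rewrite -actMv mulVg act1. Qed.

Lemma actVK w : cancel (action w^-1%g) (action w).
Proof. by move=> v; rewrite -actMv mulgV act1. Qed.

Lemma Waff_subgroup : is_subgroup (Waff D).
Proof. by have [] := W_Waff_Omega D. Qed.

Lemma Waff_permutes w : Waff D w -> permutes_affroots A (action w).
Proof. by move=> hw; apply: permutes_affroots_weyl; have [h _ _] := Waff_bij D; apply: h. Qed.

Lemma Waff_lift f : affine_weyl A f -> exists2 w, Waff D w & action w = f.
Proof. by have [_ _ h] := Waff_bij D => /h[w hw <-]; exists w. Qed.

Lemma affine_weyl_arefl a k : a \in roots A -> affine_weyl A (arefl A a k).
Proof.
by move=> ha; exists [:: (a, k)] => // p; rewrite inE => /eqP ->.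
Qed.

Lemma Saff_lift a k : is_wall A (facet A x0) a k ->
  exists2 s, Saff D s & action s = arefl A a k.
Proof.
move=> hw; have [ha _] := hw; have [s hs e] := Waff_lift (affine_weyl_arefl k ha).
by exists s => //; split=> //; exists a, k; rewrite A0_facet.
Qed.

Lemma SaffP s : Saff D s -> Waff D s /\
  exists a k, is_wall A (facet A x0) a k /\ action s = arefl A a k.
Proof. by rewrite /Saff /Saff_of A0_facet. Qed.

Lemma Saff_actK s : Saff D s -> involutive (action s).
Proof. by case/SaffP => _ [a [k [[ha _] ->]]]; exact: areflK. Qed.

Lemma Saff_actV s : Saff D s -> action s^-1%g = action s.
Proof. by move=> hs; apply/funext => v; rewrite -[v in LHS](Saff_actK hs) actK. Qed.

Lemma SaffV s : Saff D s -> Saff D s^-1%g.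
Proof.
move=> hs; have [hW [a [k [hw e]]]] := hs.
split; first exact: (subgroupV Waff_subgroup).
by exists a, k; rewrite Saff_actV.
Qed.

Lemma gallery_lift y : off_walls A y -> exists t : seq W,
  [/\ {in t, forall s, Saff D s}, dist x0 y = (2 * size t)%N &
      facet A x0 (action (\prod_(s <- t) s)%g y)].
Proof.
move=> hy; have [s [s1 -> s3]] := gallery x0_off hy.
elim: s => [|p s IH] /= in y {hy} s1 s3 *.
  by exists [::]; rewrite big_nil act1.
have [|t [t1 t2 t3]] := IH (arefl A p.1 p.2 y) _ s3.
  by move=> q qs; apply: s1; rewrite in_cons qs orbT.
have [r hr er] := Saff_lift (s1 p (mem_head _ _)).
(* The product acts on the left, so the first reflection of the gallery is the
  last letter. *)
exists (rcons t r); split; last by rewrite -cats1 big_cat big_seq1 /= actMv er.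
  by move=> q; rewrite mem_rcons in_cons => /orP[/eqP->|/t1].
by rewrite size_rcons; lia.
Qed.

Lemma Saff_word_Waff (t : seq W) : {in t, forall s, Saff D s} ->
  Waff D (\prod_(s <- t) s)%g.
Proof.
elim: t => [|s t IH] h; first by rewrite big_nil; exact: subgroup1 Waff_subgroup.
rewrite big_cons; apply: (subgroupM Waff_subgroup).
  by have [] := h s (mem_head _ _).
by apply: IH => q qt; apply: h; rewrite in_cons qt orbT.
Qed.

Lemma Omega_of_facet w : permutes_affroots A (action w) ->
  permutes_affroots A (action w^-1%g) -> facet A x0 (action w x0) ->
  Omega_of A action w.
Proof.
have stable u : permutes_affroots A (action u) -> facet A x0 (action u x0) ->
    forall y, facet A x0 y -> facet A x0 (action u y).
  move=> hu /(facetP _ x0_off)[_ hl] y /(facetP _ x0_off)[yo yl].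
  apply/(facetP _ x0_off); split; first exact: off_walls_permutes.
  have [s [m [s1 s2 s3]]] := hu => a ha.
  rewrite -hl // !(level_permuted s3) // yl //; exact: s1.
move=> hw hV hx; have hVx : facet A x0 (action w^-1%g x0).
  apply/(facetP _ x0_off); split; first exact: off_walls_permutes.
  apply/wall_dist_eq0; rewrite -(wall_dist_permutes _ _ hw) actVK wall_dist_sym.
  by apply/wall_dist_eq0; have /(facetP _ x0_off)[] := hx.
rewrite /Omega_of /= A0_facet; apply/seteqP; split.
  by move=> _ [y hy <-]; apply: stable.
by move=> y hy; exists (action w^-1%g y); [apply: stable | rewrite actVK].
Qed.

(** Simple transitivity on alcoves is the triviality of the intersection of
  Waff and Omega. *)
Lemma Waff_facet1 w : Waff D w -> facet A x0 (action w x0) -> w = 1%g.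
Proof.
move=> hw hx; have [_ _ _ hI _] := W_Waff_Omega D.
have : (Waff D `&` Omega_of A action) w.
  split=> //; apply: Omega_of_facet => //; apply: Waff_permutes => //.
  exact: (subgroupV Waff_subgroup).
by rewrite hI.
Qed.

Lemma dist_Saff_word (t : seq W) : {in t, forall s, Saff D s} ->
  (dist x0 (action (\prod_(s <- t) s)%g x0) <= 2 * size t)%N.
Proof.
elim: t => [|s t IH] h.
  by rewrite big_nil act1 /= leqn0; apply/eqP/wall_dist_eq0.
rewrite big_cons actMv; have hs := h s (mem_head _ _).
have [hW [a [k [hw e]]]] := SaffP hs.
apply: leq_trans (wall_dist_triangle A (action s x0) _ _) _.
rewrite (wall_dist_permutes _ _ (Waff_permutes hW)).
have {}IH : (dist x0 (action (\prod_(j <- t) j)%g x0) <= 2 * size t)%N.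
  by apply: IH => q qt; apply: h; rewrite in_cons qt orbT.
have := wall_dist_arefl x0_off x0_off hw; rewrite wall_dist_sym -e.
have -> : dist x0 x0 = 0%N by apply/wall_dist_eq0.
have hlev := level_wall x0_off hw => hds.
have hd : (dist x0 (action s x0) <= 2)%N by lia.
by rewrite /= mulnS; exact: leq_add hd IH.
Qed.

(** A gallery gives a word of that length, and no word is shorter as each
  letter crosses one hyperplane. *)
Lemma word_length_dist w : Waff D w ->
  (2 * word_length (Saff D) w)%N = dist x0 (action w x0).
Proof.
move=> hw; have hV := subgroupV Waff_subgroup hw.
(* The word read along a gallery brings the inverse of w back to 1, so it is w. *)
have [t [t1 t2 t3]] := gallery_lift (off_walls_permutes (Waff_permutes hV) x0_off).
have tw : (\prod_(s <- t) s = w)%g.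
  have : (\prod_(s <- t) s * w^-1)%g = 1%g.
    apply: Waff_facet1; last by rewrite actMv.
    exact: (subgroupM Waff_subgroup (Saff_word_Waff t1)).
  by move/(congr1 (fun g => g * w)%g); rewrite mulgVK mul1g.
have td : dist x0 (action w x0) = (2 * size t)%N.
  by rewrite -t2 -[RHS](wall_dist_permutes _ _ (Waff_permutes hw)) actVK wall_dist_sym.
rewrite td; congr (2 * _)%N.
have low m : is_word (Saff D) w m -> (size t <= m)%N.
  case=> u [u1 <- u3]; have := dist_Saff_word u1; rewrite u3 td; lia.
have ht : is_word (Saff D) w (size t) by exists t.
rewrite /word_length; apply: xget_unique; first by split.
by move=> m [m1 m2]; apply/eqP; rewrite eqn_leq m2 //= low.
Qed.

Lemma Omega_dist w : Omega_of A action w -> facet A x0 (action w x0).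
Proof.
rewrite /Omega_of /= A0_facet => <-; exists x0 => //; exact: facet_refl.
Qed.

(** W permutes the alcoves, since it is generated by Waff and the stabilizer of
  the base alcove; so it preserves the union of the hyperplanes. *)
Lemma act_off_walls w y : off_walls A y -> off_walls A (action w y).
Proof.
move=> hy; have [t [t1 _ t3]] := gallery_lift hy.
set u := (\prod_(s <- t) s)%g in t3.
have [_ _ _ _ /(_ (w * u^-1)%g)[x [o [hx ho e]]]] := W_Waff_Omega D.
have -> : action w y = action x (action o (action u y)).
  by rewrite -!actMv -e mulgVK.
apply: off_walls_permutes (Waff_permutes hx) _.
suff /(facetP _ x0_off)[] : facet A x0 (action o (action u y)) by [].
have := ho; rewrite /Omega_of /= A0_facet => <-.
by exists (action u y).
Qed.

(** If a(nu) were not an integer for the translation vector nu of an element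
  of Lambda, this translation would move a generic point of a hyperplane of
  direction a off all the hyperplanes. *)
Lemma Lambda_integral (lam : W) nu : Lambda D lam ->
  (forall v, action lam v = v + nu) ->
  {in roots A, forall a, exists m : int, pairing a nu = m%:~R}.
Proof.
move=> hl hnu a ha; apply: contrapT => nint.
pose g b := b - (pairing b (coroot A a) / 2) *: a.
pose L := [seq g b | b <- roots A & (b != a) && (b != - a)].
have [u hu] : exists u : 'rV[K]_n, {in L, forall f, pairing f u != 0}.
  apply: generic_vector; apply/mapP => -[b].
  rewrite mem_filter => /andP[/andP[ba bNa] hb] /esym g0.
  have [e|e] : b = a \/ b = - a; last 2 first.
  - by rewrite e eqxx in ba.
  - by rewrite e eqxx in bNa.
  apply: (root_kernel ha hb) => v av; have := congr1 (fun f => pairing f v) g0.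
  by rewrite pairingBl pairingZl av mulr0 subr0 pairing0l.
(* The projection of u to the kernel of a along the coroot. *)
pose q := u - (pairing a u / 2) *: coroot A a.
have qE b : pairing b q = pairing (g b) u.
  by rewrite pairingB pairingZ pairingBl pairingZl; ring.
have aq : pairing a q = 0 by rewrite pairingB pairingZ coroot2 //; field.
have near_off : \forall t \near (0 : K)^'+,
    {in roots A, forall b, forall k : int, pairing b (nu + t *: q) != k%:~R}.
  apply: near_all_seq => b hb.
  have [/orP ba|/norP[ba bNa]] := boolP ((b == a) || (b == - a)).
    apply: nearW => t k; apply/eqP; rewrite pairingD pairingZ.
    case: ba => /eqP ->; rewrite ?pairingNl aq ?oppr0 mulr0 addr0 => e; apply: nint.
      by exists k.
    by exists (- k); rewrite rmorphN /= -e opprK.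
  have gu : pairing b q != 0.
    by rewrite qE; apply: hu; apply/mapP; exists b; rewrite // mem_filter ba bNa.
  apply: filterS (near_nonint (pairing b nu) gu) => t h k.
  by rewrite pairingD pairingZ.
have [t ht] := right_nbhs_exists near_off.
have := act_off_walls lam^-1%g ht.
have -> : action lam^-1%g (nu + t *: q) = t *: q.
  by rewrite addrC -hnu actK.
by move=> /(_ a ha 0)/eqP; rewrite pairingZ aq mulr0.
Qed.

(** W is generated by Lambda, whose translations shift levels by integers, and
  by a subgroup of Waff. *)
Lemma act_permutes w : permutes_affroots A (action w).
Proof.
have [_ _ _ _ /(_ w)[lam [u [hlam hu ->]]]] := W_Lambda_W0 D.
rewrite actM; apply: permutes_affroots_comp.
  have [nu [_ hnu]] := Lambda_transl D; have {}hnu v := hnu lam v hlam.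
  have hm := Lambda_integral hlam hnu.
  exists id, (fun a => Num.floor (pairing a (nu lam))); split=> // a ha v.
  by have [m hm'] := hm a ha; rewrite hnu pairingD hm' intrKfloor.
apply: Waff_permutes; apply: hu; split; first exact: Waff_subgroup.
by move=> s [].
Qed.

(** The factor of w in Omega keeps x0 in the base alcove, so that only the
  factor in Waff moves it across hyperplanes. *)
Lemma ell_dist w : (2 * ell D w)%N = dist x0 (action w x0).
Proof.
have [_ _ _ _ /(_ w)[x [y [hx hy e]]]] := W_Waff_Omega D.
have : [set x | Waff D x /\ exists2 y, Omega_of A (act D) y & w = (x * y)%g]
    (aff_part D w).
  by apply: (@xgetPex _ 1%g); exists x; split=> //; exists y.
rewrite /ell; move: (aff_part D w) => {hx e}x [hx [{hy}y hy ->]].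
rewrite word_length_dist // actMv.
rewrite -(wall_dist_permutes _ _ (act_permutes x^-1%g)) actK.
rewrite -[RHS](wall_dist_permutes _ _ (act_permutes x^-1%g)) actK.
have /(facetP _ x0_off)[_ hl] := Omega_dist hy.
rewrite /wall_dist big_seq [RHS]big_seq; apply: eq_bigr => a.
by rewrite mem_undup => ha; rewrite hl.
Qed.

Lemma dist_act w y v : dist (action w y) v = dist y (action w^-1%g v).
Proof. by rewrite -(wall_dist_permutes _ _ (act_permutes w^-1%g)) actK. Qed.

Lemma ell_eq_act w x : action w =1 action x -> ell D w = ell D x.
Proof. by move=> e; have := ell_dist w; have := ell_dist x; rewrite e; lia. Qed.

Lemma ellM_le w x : (ell D (w * x)%g <= ell D w + ell D x)%N.
Proof.
have := wall_dist_triangle A (action w x0) x0 (action (w * x)%g x0).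
rewrite actMv (wall_dist_permutes _ _ (act_permutes w)) -actMv -!ell_dist; lia.
Qed.

Lemma ellV w : ell D w^-1%g = ell D w.
Proof.
have := ell_dist w; have := ell_dist w^-1%g.
rewrite -dist_act wall_dist_sym => <-; lia.
Qed.

Lemma ell1_group : ell D 1%g = 0%N.
Proof.
have := ell_dist 1%g; rewrite act1.
have -> : dist x0 x0 = 0%N by apply/wall_dist_eq0.
lia.
Qed.

(** Moving s to the other side, the length of s w is the distance from s x0 to
  w x0, and s x0 differs from x0 by one wall crossing. *)
Lemma ell_wall_mul a k s w :
  is_wall A (facet A x0) a k -> Saff D s -> action s = arefl A a k ->
  (ell D (s * w)%g + absz (level a x0 - level a (action w x0))%R =
   ell D w + absz (- 2 * k - 1 - level a x0 - level a (action w x0))%R)%N.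
Proof.
move=> hw hs e; have := wall_dist_arefl x0_off (act_off_walls w x0_off) hw.
rewrite -e dist_act Saff_actV // -actMv -!ell_dist; lia.
Qed.

Lemma ell_Saff_mul s w : Saff D s ->
  (ell D (s * w)%g = (ell D w).+1 \/ ell D w = (ell D (s * w)%g).+1)%N.
Proof.
move=> hs; have [_ [a [k [hw e]]]] := SaffP hs.
have := ell_wall_mul w hw hs e; have [->|->] := level_wall x0_off hw; lia.
Qed.

Lemma ell_Saff s : Saff D s -> ell D s = 1%N.
Proof.
move=> hs; have := ell_Saff_mul 1%g hs.
by rewrite mulg1 ell1_group => -[].
Qed.

(** The simple reflection comes from a wall separating x0 from the image of x0
  by the inverse of w. *)
Lemma ell_descent w : ell D w != 0%N ->
  exists2 s, Saff D s & ell D w = (ell D (w * s^-1)%g).+1.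
Proof.
move=> hw; have hV : wall_dist A x0 (action w^-1%g x0) != 0%N.
  by rewrite -ell_dist ellV; lia.
have [a [k [hwall ax ay]]] := exists_separating_wall x0_off (act_off_walls _ x0_off) hV.
have [s hs e] := Saff_lift hwall; exists s => //.
have -> : ell D (w * s^-1)%g = ell D (s * w^-1)%g.
  by rewrite -(ellV (w * s^-1)%g) invgM invgK.
have := ell_wall_mul w^-1%g hwall hs e; rewrite ax ellV; lia.
Qed.

(** When w acts as a translation, the wall of s cannot separate the base
  alcove from both of its images by w and by its inverse. *)
Lemma ell_translation_mul w s (m : 'cV[K]_n -> int) :
  {in roots A, forall a v, pairing a (action w v) = pairing a v + (m a)%:~R} ->
  Saff D s ->
  (ell D (s * w)%g = (ell D w).+1 \/ ell D (w * s)%g = (ell D w).+1)%N.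
Proof.
move=> hm hs; have [_ [a [k [hw e]]]] := SaffP hs; have [ha _] := hw.
have lw y : level a (action w y) = level a y + m a.
  by rewrite /level hm // floorDrz ?intr_int // intrKfloor.
have lV : level a (action w^-1%g x0) = level a x0 - m a.
  by have := lw (action w^-1%g x0); rewrite actVK => ->; rewrite addrK.
have := ell_wall_mul w hw hs e; have := ell_wall_mul w^-1%g hw hs e.
have -> : ell D (s * w^-1)%g = ell D (w * s)%g.
  rewrite -(ellV (w * s)%g) invgM; apply: ell_eq_act => v.
  by rewrite !actMv (Saff_actV hs).
rewrite ellV lw lV; have [->|->] := level_wall x0_off hw; lia.
Qed.

(** * Translations of the coroot lattice *)

(** All vectors of the coroot lattice have these two properties; the second one
  makes the translation shift levels by integers. *)
Definition coroot_translation (mu : 'rV[K]_n) : Prop :=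
  affine_weyl A (fun v => v + mu) /\
  {in roots A, forall a, exists k : int, pairing a mu = k%:~R}.

Lemma affine_weyl_comp f g :
  affine_weyl A f -> affine_weyl A g -> affine_weyl A (f \o g).
Proof.
move=> [s s1 ->] [t t1 ->]; exists (s ++ t).
  by move=> q; rewrite mem_cat => /orP[/s1|/t1].
by rewrite foldr_cat; elim: s {s1} => //= q s <-.
Qed.

Lemma coroot_translationD mu mu' : coroot_translation mu ->
  coroot_translation mu' -> coroot_translation (mu + mu').
Proof.
move=> [h1 h2] [h1' h2']; split.
  have := affine_weyl_comp h1' h1.
  by congr affine_weyl; apply/funext => v /=; rewrite addrA.
move=> a ha; have [k e] := h2 a ha; have [k' e'] := h2' a ha.
by exists (k + k'); rewrite pairingD e e' rmorphD.
Qed.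

Lemma coroot_translation0 : coroot_translation 0.
Proof.
split; first by exists [::] => //; apply/funext => v; rewrite addr0.
by move=> a _; exists 0; rewrite pairing0.
Qed.

Lemma coroot_translation_coroot a k : a \in roots A ->
  coroot_translation (k%:~R *: coroot A a).
Proof.
move=> ha; split; last first.
  move=> b hb; have [l e] := root_integral ha hb.
  by exists (k * l); rewrite pairingZ e rmorphM.
(* Reflecting in two parallel hyperplanes is a translation. *)
have := affine_weyl_comp (affine_weyl_arefl (- k) ha) (affine_weyl_arefl 0 ha).
congr affine_weyl; apply/funext => v /=.
rewrite {1}/arefl /affroot; have := affroot_arefl 0 v ha.
rewrite /affroot !addr0 => ->; rewrite /arefl /affroot addr0 rmorphN /=.
by rewrite -opprD scaleNr opprK scalerDl addrA subrK.
Qed.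

Lemma coroot_translationMn mu N :
  coroot_translation mu -> coroot_translation (mu *+ N).
Proof.
move=> h; elim: N => [|N IH]; first by rewrite mulr0n; exact: coroot_translation0.
by rewrite mulrS; exact: coroot_translationD.
Qed.

Lemma coroot_translation_sum (s : seq 'cV[K]_n) (k : 'cV[K]_n -> int) :
  {subset s <= roots A} ->
  coroot_translation (\sum_(a <- s) (k a)%:~R *: coroot A a).
Proof.
elim: s => [|a s IH] h; first by rewrite big_nil; exact: coroot_translation0.
rewrite big_cons; apply: coroot_translationD.
  by apply: coroot_translation_coroot; apply: h; rewrite mem_head.
by apply: IH => b bs; apply: h; rewrite in_cons bs orbT.
Qed.

Lemma archimedean_seq (T : eqType) (r : seq T) (f : T -> K) (C : K) :
  exists N : nat, {in r, forall t, 0 < f t -> C < N%:R * f t}.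
Proof.
elim: r => [|t r [N hN]]; first by exists 0%N.
exists (N + Num.bound `|C / f t|)%N => u; rewrite in_cons natrD mulrDl.
case/orP => [/eqP -> | ur] fu.
  have : C < (Num.bound `|C / f t|)%:R * f t.
    rewrite -ltr_pdivrMr //; apply: le_lt_trans (ler_norm _) _.
    exact: archi_boundP.
  by move=> ?; have : 0 <= N%:R * f t; [rewrite mulr_ge0 // ltW | lra].
have := hN u ur fu.
by have : 0 <= (Num.bound `|C / f t|)%:R * f u; [rewrite mulr_ge0 // ltW | lra].
Qed.

(** Rounding the coefficients of N delta on the coroots gives a lattice vector
  within a bounded distance of N delta; for N large the signs of the roots on
  delta prevail over the rounding and over the addition of a coroot. *)
Lemma coroot_translation_near (delta : 'rV[K]_n) :
  exists mu, coroot_translation mu /\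
  {in roots A, forall a, 0 < pairing a delta -> 0 < pairing a mu /\
     {in roots A, forall c, 0 < pairing a (mu + coroot A c)}}.
Proof.
have [r er] := coroots_span A delta.
pose Q := undup (roots A).
pose C := \sum_(b <- Q) \sum_(a <- Q) `|pairing b (coroot A a)|.
have bound1 b : b \in roots A ->
    \sum_(a <- Q) `|pairing b (coroot A a)| <= C.
  move=> hb; rewrite /C [leRHS](bigD1_seq b) ?undup_uniq ?mem_undup //=.
  by rewrite lerDl sumr_ge0 // => c _; apply: sumr_ge0.
have bound2 b a : b \in roots A -> a \in roots A -> `|pairing b (coroot A a)| <= C.
  move=> hb ha; apply: le_trans (bound1 b hb).
  rewrite [leRHS](bigD1_seq a) ?undup_uniq ?mem_undup //=.
  by rewrite lerDl sumr_ge0.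
(* One C for the rounding error, one for the added coroot. *)
have [N hN] := archimedean_seq (roots A) (fun a => pairing a delta) (2 * C).
pose mu := \sum_(a <- Q) (Num.floor (N%:R * r a))%:~R *: coroot A a.
have near_mu b : b \in roots A -> N%:R * pairing b delta - C <= pairing b mu.
  move=> hb; rewrite er !pairing_sum mulr_sumr lerBlDr -lerBlDl -sumrB.
  apply: le_trans (bound1 b hb); apply: ler_sum => a _; rewrite !pairingZ.
  have /andP[f1 f2] := floor_itv (N%:R * r a).
  rewrite rmorphD /= in f2; rewrite mulrA -mulrBl.
  apply: le_trans (ler_norm _) _; rewrite normrM ler_piMl //.
  by rewrite ger0_norm; lra.
exists mu; split.
  by apply: coroot_translation_sum => a; rewrite mem_undup.
move=> b hb bd; have := hN b hb bd; have := near_mu b hb => h1 h2.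
have C0 : 0 <= C by apply: sumr_ge0 => c _; apply: sumr_ge0.
split; first lra.
move=> c hc; rewrite pairingD; have := bound2 b c hb hc.
by have := ler_norm (- pairing b (coroot A c)); rewrite normrN; lra.
Qed.

(** * Elements whose conjugates do not grow *)

(** Translating x0 by N mu moves it away from w x0 with respect to every root,
  so that the lengths of w and of the translation x by - N mu add. Conjugating
  w by x shifts the level of a on the image of x0 by N times
  (s a)(mu) - a(mu), which must vanish as the length does not change with N. *)
Lemma bounded_conj_fixes w (s : 'cV[K]_n -> 'cV[K]_n) (m : 'cV[K]_n -> int)
    (mu : 'rV[K]_n) :
  (forall x, ell D (x * w)%g = (ell D x + ell D w)%N ->
     ell D (x * w * x^-1)%g = ell D w) ->
  {in roots A, forall a, s a \in roots A} ->
  {in roots A, forall a v, pairing a (action w v) = pairing (s a) v + (m a)%:~R} ->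
  coroot_translation mu ->
  {in roots A, forall a, 0 < pairing a (x0 - action w x0) -> 0 < pairing a mu} ->
  {in roots A, forall a, pairing (s a) mu = pairing a mu}.
Proof.
move=> hconj s1 s3 hmu hpos.
have [_ hint] := hmu; pose M a : int := Num.floor (pairing a mu).
have ME a : a \in roots A -> pairing a mu = (M a)%:~R.
  by move=> /hint[k e]; rewrite /M e intrKfloor.
pose d a : int := level a x0 - level a (action w x0).
have sign a : a \in roots A ->
    [\/ d a = 0, 0 <= d a /\ 0 < M a | d a <= 0 /\ M a < 0].
  move=> ha; have [lt|gt|eq] := ltgtP (pairing a (x0 - action w x0)) 0.
  - apply: Or33; have := hpos _ (root_opp ha).
    rewrite !pairingNl oppr_gt0 => /(_ lt); rewrite ME // oppr_gt0.
    rewrite -[0]/(0%:~R) ltr_int => ->; split=> //.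
    by rewrite subr_le0; apply: le_floor; rewrite -subr_le0 -pairingB ltW.
  - apply: Or32; have := hpos a ha gt; rewrite ME //.
    rewrite -[0]/(0%:~R) ltr_int => ->; split=> //.
    by rewrite subr_ge0; apply: le_floor; rewrite -subr_ge0 -pairingB ltW.
  - apply: Or31; move/eqP: eq; rewrite pairingB subr_eq0 => /eqP eq.
    by rewrite /d /level eq subrr.
have shift (N : nat) a y : a \in roots A ->
    level a (y + mu *+ N) = level a y + M a * N%:Z.
  move=> ha; rewrite /level pairingD -scaler_nat pairingZ ME //.
  have -> : N%:R * (M a)%:~R = (M a * N%:Z)%:~R :> K by rewrite rmorphM mulrC.
  by rewrite floorDrz ?intr_int // intrKfloor.
have lw y a : a \in roots A -> level a (action w y) = level (s a) y + m a.
  by move=> ha; exact: (level_permuted s3 ha).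
have main (N : nat) a : a \in roots A ->
    (absz (d a + (M a - M (s a)) * N%:Z)%R <= 2 * ell D w)%N.
  move=> ha; have [hW _] := coroot_translationMn N hmu.
  have [X _ eX] := Waff_lift hW.
  have XE y : action X y = y + mu *+ N by rewrite eX.
  have add : ell D (X^-1 * w)%g = (ell D X^-1%g + ell D w)%N.
    have e1 := ell_dist (X^-1 * w)%g; rewrite actMv -dist_act in e1.
    have e2 := ell_dist X^-1%g; rewrite -dist_act in e2.
    have e3 := ell_dist w.
    suff : (dist (action X x0) (action w x0) =
            dist (action X x0) x0 + dist x0 (action w x0))%N by lia.
    rewrite /wall_dist -big_split /= big_seq [RHS]big_seq; apply: eq_bigr => b.
    rewrite mem_undup => hb; rewrite XE shift //.
    by have := sign b hb; rewrite /d => -[?|[? ?]|[? ?]]; nia.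
  have e := hconj _ add; rewrite -e ell_dist !actMv -dist_act invgK !XE.
  rewrite /wall_dist (bigD1_seq a) ?undup_uniq ?mem_undup //=.
  rewrite !shift // lw // shift ?s1 // /d lw //.
  by apply: leq_trans (leq_addr _ _); rewrite leq_eqVlt; apply/orP; left; apply/eqP; congr absz; ring.
move=> a ha; rewrite !ME ?s1 //; congr _%:~R.
(* For this N, a nonzero multiple of N exceeds the bound of main. *)
have := main (2 * ell D w + absz (d a) + 1)%N a ha.
nia.
Qed.

(** The linear part of w fixes a lattice vector together with its translates by
  all coroots, hence it fixes the coroots, which span. *)
Lemma bounded_conj_translation w :
  (forall x, ell D (x * w)%g = (ell D x + ell D w)%N ->
     ell D (x * w * x^-1)%g = ell D w) ->
  exists m : 'cV[K]_n -> int,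
  {in roots A, forall a v, pairing a (action w v) = pairing a v + (m a)%:~R}.
Proof.
move=> hconj; have [s [m [s1 s2 s3]]] := act_permutes w; exists m.
have [mu [hmu hpos]] := coroot_translation_near (x0 - action w x0).
move=> a ha v; rewrite s3 //; congr (pairing _ v + _).
apply: (eq_of_pairing_coroots (Phi := A)) => c hc.
have fix1 := bounded_conj_fixes hconj s1 s3 hmu (fun b hb h => (hpos b hb h).1) ha.
have hc1 : coroot_translation (mu + coroot A c).
  apply: coroot_translationD => //.
  by have := coroot_translation_coroot 1 hc; rewrite scale1r.
have := bounded_conj_fixes hconj s1 s3 hc1 (fun b hb h => (hpos b hb h).2 c hc) ha.
by rewrite !pairingD fix1 => /addrI.
Qed.

End IwahoriWeylLength.

(** * Products and coefficients in the algebra *)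

Section HeckeAlgebra.
Variables (K : realType) (n : nat) (A : apartment K n) (W : groupType).
Variable D : iwahoriWeyl A W.
Variables (Z W1 : groupType) (i : Z -> W1) (p : W1 -> W).
Hypothesis hext : is_extension i p.
Variables (R : comPzRingType) (c : W1 -> {fsfun Z -> R with 0}).
Variables (H : pzRingType) (eta : {rmorphism R -> H}) (T : W1 -> H).
Hypothesis hH : is_hecke D i p c eta T.
Variable x0 : 'rV[K]_n.
Hypothesis x0_off : off_walls A x0.
Hypothesis A0_facet : A0 A = facet A x0.
Implicit Types (h : H) (r : R) (s w x y : W1) (t : Z).

Local Notation len := (ell1 D p).
Local Notation lincomb := (lincomb eta T).

Definition coef h : {fsfun W1 -> R with 0} := projT1 (cid (hecke_basis hH h)).

Lemma coefK h : h = lincomb (coef h).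
Proof. exact: (projT2 (cid (hecke_basis hH h))).1. Qed.

Lemma lincombK a : coef (lincomb a) = a.
Proof. exact: (projT2 (cid (hecke_basis hH (lincomb a)))).2. Qed.

Lemma lincomb_fset (a : {fsfun W1 -> R with 0}) (S : {fset W1}) :
  (finsupp a `<=` S)%fset -> lincomb a = \sum_(w <- S) eta (a w) * T w.
Proof.
move=> aS; rewrite /lincomb; apply: big_fset_incl => // w wS.
by rewrite memNfinsupp => /eqP ->; rewrite rmorph0 mul0r.
Qed.

Lemma coefD h h' w : coef (h + h') w = coef h w + coef h' w.
Proof.
set a := coef h; set b := coef h'.
pose S := (finsupp a `|` finsupp b)%fset.
pose d : {fsfun W1 -> R with 0} := [fsfun w in S => a w + b w | 0].
have dE v : d v = a v + b v.
  rewrite fsfunE; case: ifP => // /negbT; rewrite in_fsetU negb_or !memNfinsupp.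
  by move=> /andP[/eqP -> /eqP ->]; rewrite addr0.
suff -> : h + h' = lincomb d by rewrite lincombK dE.
rewrite (coefK h) (coefK h') -/a -/b.
rewrite (lincomb_fset (fsubsetUl _ (finsupp b))) (lincomb_fset (fsubsetUr (finsupp a) _)).
rewrite (@lincomb_fset d S); last exact: finsupp_sub.
by rewrite -big_split; apply: eq_bigr => v _; rewrite dE rmorphD mulrDl.
Qed.

Lemma coefZ r h w : coef (eta r * h) w = r * coef h w.
Proof.
set a := coef h.
pose d : {fsfun W1 -> R with 0} := [fsfun w in finsupp a => r * a w | 0].
have dE v : d v = r * a v.
  by rewrite fsfunE; case: ifP => // /negbT; rewrite memNfinsupp => /eqP ->; rewrite mulr0.
suff -> : eta r * h = lincomb d by rewrite lincombK dE.
rewrite (coefK h) -/a (@lincomb_fset d (finsupp a)); last exact: finsupp_sub.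
by rewrite mulr_sumr; apply: eq_bigr => v _; rewrite dE rmorphM mulrA.
Qed.

Lemma coef0 w : coef 0 w = 0.
Proof. by have := coefZ 0 0 w; rewrite mulr0 mul0r. Qed.

Lemma coefT x y : coef (T x) y = (x == y)%:R.
Proof.
pose d : {fsfun W1 -> R with 0} := [fsfun w in [fset x]%fset => 1 | 0].
suff -> : T x = lincomb d.
  by rewrite lincombK fsfunE in_fset1 eq_sym; case: eqP.
rewrite (@lincomb_fset d [fset x]%fset); last exact: finsupp_sub.
by rewrite big_seq_fset1 fsfunE in_fset1 eqxx rmorph1 mul1r.
Qed.

Lemma coef_sum (I : Type) (l : seq I) (r : I -> R) (f : I -> H) w :
  coef (\sum_(j <- l) eta (r j) * f j) w = \sum_(j <- l) r j * coef (f j) w.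
Proof.
elim: l => [|j l IH]; first by rewrite !big_nil coef0.
by rewrite !big_cons coefD coefZ IH.
Qed.

Lemma suppP h w : supp eta T h w <-> coef h w != 0.
Proof.
split=> [[a -> ]|hw]; first by rewrite lincombK.
by exists (coef h); first exact: coefK.
Qed.

Lemma pM x y : p (x * y)%g = (p x * p y)%g.
Proof. exact: ext_pM hext _ _. Qed.

Lemma p1 : p 1%g = 1%g.
Proof. by apply: (mulgI (p 1)%g); rewrite -pM !mulg1. Qed.

Lemma pV x : p x^-1%g = (p x)^-1%g.
Proof. by apply: (mulgI (p x)); rewrite -pM !mulgV p1. Qed.

Lemma p_i t : p (i t) = 1%g.
Proof. by apply/(ext_exact hext); exists t. Qed.

Lemma lenM_le x y : (len (x * y)%g <= len x + len y)%N.
Proof. by rewrite /ell1 pM; exact: (ellM_le D x0_off A0_facet). Qed.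

Lemma lenV x : len x^-1%g = len x.
Proof. by rewrite /ell1 pV; exact: (ellV D x0_off A0_facet). Qed.

Lemma len_imul t x : len (i t * x)%g = len x.
Proof. by rewrite /ell1 pM p_i mul1g. Qed.

Lemma len0_mull x y : len x = 0%N -> len (x * y)%g = len y.
Proof.
move=> x_0; apply/eqP; rewrite eqn_leq; apply/andP; split.
  by have := lenM_le x y; rewrite x_0.
by have := lenM_le x^-1%g (x * y)%g; rewrite mulKg lenV x_0.
Qed.

Lemma len_SaffV_mul s x : Saff D (p s) -> len (s^-1 * x)%g = len (s * x)%g.
Proof.
move=> hs; rewrite /ell1 !pM pV; apply: (ell_eq_act x0_off A0_facet) => v.
by rewrite !actMv (Saff_actV A0_facet hs).
Qed.

Lemma len_Saff s : Saff D (p s) -> len s = 1%N.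
Proof. exact: (ell_Saff x0_off A0_facet). Qed.

Lemma len_descent x : len x != 0%N ->
  exists s, exists x', [/\ Saff D (p s), x = (x' * s)%g & len x = (len x').+1].
Proof.
move=> /(ell_descent x0_off A0_facet)[s0 hs e].
have [s es] := ext_surj hext s0; exists s, (x * s^-1)%g.
by rewrite mulgVK es /ell1 pM pV es.
Qed.

(** When s shortens w, the quadratic relation turns T_s T_w into a combination
  of elements of the length of w, so that nothing remains in length
  l(x) + l(w); otherwise the letter s of x passes to w. *)
Lemma coef_TT x w y : (len x + len w <= len y)%N ->
  coef (T x * T w) y = ((x * w)%g == y)%:R.
Proof.
have [N] := ubnP (len x); elim: N => // N IH in x w * => xN xy.
have [x_0|xn0] := eqVneq (len x) 0%N.
  by rewrite (hecke_braid hH) ?coefT // x_0 len0_mull.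
have [s [x' [hs ex lx]]] := len_descent xn0.
have ls := len_Saff hs.
have -> : T x = T x' * T s.
  by rewrite (hecke_braid hH) -ex // lx ls addn1.
rewrite -mulrA {1}ex -mulgA.
have [up|down] : len (s * w)%g = (len w).+1 \/ len w = (len (s * w)%g).+1.
  by rewrite /ell1 pM; exact: (ell_Saff_mul x0_off A0_facet).
- rewrite (hecke_braid hH) ?ls ?up ?add1n //.
  by apply: IH; [rewrite lx in xN; lia | rewrite up lx in xy *; lia].
have Tw : T s * T (s^-1 * w)%g = T w.
  by rewrite (hecke_braid hH) mulVKg // ls len_SaffV_mul // down add1n.
have -> : T s * T w = \sum_(t <- finsupp (c s)) eta (c s t) * T (i t * w)%g.
  rewrite -{1}Tw mulrA (hecke_quad hH) // -mulrA Tw mulr_suml.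
  apply: eq_bigr => t _; rewrite -mulrA (hecke_braid hH) // len_imul.
  by rewrite /ell1 p_i (ell1_group D x0_off A0_facet).
have -> : T x' * (\sum_(t <- finsupp (c s)) eta (c s t) * T (i t * w)%g) =
    \sum_(t <- finsupp (c s)) eta (c s t) * (T x' * T (i t * w)%g).
  rewrite mulr_sumr; apply: eq_bigr => t _.
  by rewrite mulrA -(hecke_central hH) mulrA.
rewrite coef_sum big1 => [|t _].
  case: eqP => // e; have := lenM_le x' (s * w)%g; rewrite e; lia.
rewrite IH ?len_imul; [|lia..].
case: eqP => [e|_]; last by rewrite mulr0.
have := lenM_le x' (i t * w)%g; rewrite e len_imul; lia.
Qed.

Lemma sum_coef_delta h y (f : W1 -> W1) (v : W1) :
  (forall w, (f w == y) = (w == v)) ->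
  \sum_(w <- finsupp (coef h)) coef h w * (f w == y)%:R = coef h v.
Proof.
move=> hf; under eq_bigr do rewrite hf.
have [vS|vS] := boolP (v \in finsupp (coef h)).
  rewrite (bigD1_seq v) ?fset_uniq //= eqxx mulr1 big1 ?addr0 // => w /negPf ->.
  by rewrite mulr0.
rewrite big_seq big1 => [|w wS]; first by move: vS; rewrite memNfinsupp => /eqP.
by case: eqP vS => [<-|_ _]; [rewrite wS | rewrite mulr0].
Qed.

Section TopCoefficients.
Variables (h : H) (M : nat).
Hypothesis hM : forall w, coef h w != 0 -> (len w <= M)%N.

Lemma coef_T_mul x y : (len x + M <= len y)%N ->
  coef (T x * h) y = coef h (x^-1 * y)%g.
Proof.
move=> xy.
have -> : T x * h = \sum_(w <- finsupp (coef h)) eta (coef h w) * (T x * T w).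
  rewrite {1}(coefK h) mulr_sumr; apply: eq_bigr => w _.
  by rewrite mulrA -(hecke_central hH) mulrA.
rewrite coef_sum.
rewrite -(@sum_coef_delta h y (fun w => (x * w)%g)); last first.
  by move=> w; apply/eqP/eqP => [<-|->]; rewrite ?mulKg ?mulVKg.
rewrite big_seq [RHS]big_seq; apply: eq_bigr => w.
rewrite mem_finsupp => /hM wM; rewrite coef_TT //; lia.
Qed.

Lemma coef_mul_T x y : (len x + M <= len y)%N ->
  coef (h * T x) y = coef h (y * x^-1)%g.
Proof.
move=> xy.
have -> : h * T x = \sum_(w <- finsupp (coef h)) eta (coef h w) * (T w * T x).
  by rewrite {1}(coefK h) mulr_suml; apply: eq_bigr => w _; rewrite mulrA.
rewrite coef_sum.
rewrite -(@sum_coef_delta h y (fun w => (w * x)%g)); last first.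
  by move=> w; apply/eqP/eqP => [<-|->]; rewrite ?mulgK ?mulgVK.
rewrite big_seq [RHS]big_seq; apply: eq_bigr => w.
rewrite mem_finsupp => /hM wM; rewrite coef_TT //; lia.
Qed.

End TopCoefficients.

(** * The top support of a central element *)

Section Central.
Variable h : H.
Hypothesis hc : in_center h.

Local Notation top := (supp_max D p eta T h).

Lemma top_bound w : top w -> forall v, coef h v != 0 -> (len v <= len w)%N.
Proof. by move=> [_ hw] v /suppP; exact: hw. Qed.

Lemma topP w v : top w -> coef h v != 0 -> (len w <= len v)%N -> top v.
Proof.
move=> hw hv wv; split; first exact/suppP.
by move=> u /suppP /(top_bound hw) uw; apply: leq_trans wv.
Qed.

(** Both sides of T_x h = h T_x are compared at x w: on the left the coefficient
  of h at w appears, on the right the one at x w x^-1. *)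
Lemma top_conj x w : top w -> len (x * w)%g = (len x + len w)%N ->
  top (x * w * x^-1)%g.
Proof.
move=> hw e; have bd := top_bound hw.
have := coef_T_mul bd (eq_leq (esym e)); have := coef_mul_T bd (eq_leq (esym e)).
rewrite (hc (T x)) mulKg => -> e'.
apply: (topP hw); first by rewrite e'; apply/suppP; case: hw.
by have := lenM_le (x * w * x^-1)%g x; rewrite mulgVK e; lia.
Qed.

Lemma top_conjV x w : top w -> len (w * x)%g = (len w + len x)%N ->
  top (x^-1 * w * x)%g.
Proof.
move=> hw; rewrite addnC => e; have bd := top_bound hw.
have := coef_mul_T bd (eq_leq (esym e)); have := coef_T_mul bd (eq_leq (esym e)).
rewrite -(hc (T x)) mulgK mulgA => -> e'.
apply: (topP hw); first by rewrite e'; apply/suppP; case: hw.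
have ex : (x * (x^-1 * w * x) = w * x)%g by rewrite !mulgA mulgV mul1g.
by have := lenM_le x (x^-1 * w * x)%g; rewrite ex e leq_add2l.
Qed.

(** The lengths of w and of a conjugate are equal as each bounds the other. *)
Lemma top_translation w : top w -> exists m : 'cV[K]_n -> int,
  {in roots A, forall a v, pairing a (act D (p w) v) = pairing a v + (m a)%:~R}.
Proof.
move=> hw; apply: (bounded_conj_translation x0_off A0_facet) => x e.
have [y ey] := ext_surj hext x.
have hy : top (y * w * y^-1)%g by apply: top_conj; rewrite // /ell1 pM ey.
have le1 := top_bound hw ((suppP _ _).1 hy.1).
have le2 := top_bound hy ((suppP _ _).1 hw.1).
by apply/eqP; rewrite eqn_leq -ey -pV -!pM; apply/andP.
Qed.

(** As w acts by a translation, s adds to its length on one side at least. *)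
Lemma top_conj_Saff s w : Saff D (p s) -> top w -> top (s * w * s^-1)%g.
Proof.
move=> hs hw; have [m hm] := top_translation hw; have ls := len_Saff hs.
have [e|e] := ell_translation_mul x0_off A0_facet hm (SaffV A0_facet hs).
  apply: top_conj => //; rewrite ls add1n -len_SaffV_mul //.
  by rewrite /ell1 pM pV.
have := @top_conjV s^-1%g w hw; rewrite invgK; apply.
by rewrite lenV ls addn1 /ell1 pM pV.
Qed.

Lemma top_conj_closed x w : top w -> top (x * w * x^-1)%g.
Proof.
have [N] := ubnP (len x); elim: N => // N IH in x w * => xN hw.
have [x_0|xn0] := eqVneq (len x) 0%N.
  by apply: top_conj; rewrite // x_0 len0_mull.
have [s [x' [hs ex lx]]] := len_descent xn0; rewrite ex.
have -> : (x' * s * w * (x' * s)^-1 = x' * (s * w * s^-1) * x'^-1)%g.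
  by rewrite invgM !mulgA.
by apply: IH; [lia | exact: top_conj_Saff].
Qed.

Lemma top_finite : finite_set top.
Proof.
apply: (@sub_finite_set _ _ [set` finsupp (coef h)]); last exact: finite_fset.
by move=> w [/suppP hw _]; rewrite /= mem_finsupp.
Qed.

End Central.
End HeckeAlgebra.

Lemma exists_alcove_point (K : realType) (n : nat) (A : apartment K n) :
  exists2 x0, off_walls A x0 & A0 A = facet A x0.
Proof.
have [x hx e] := A0_alcove A; exists x => // a ha k; apply/eqP => xk.
by apply: (hx a ha (- k)); rewrite /hyperplane /affroot /= xk rmorphN subrr.
Qed.

Theorem theorem4p1 (K : realType) (n : nat) (A : apartment K n)
    (W : groupType) (D : iwahoriWeyl A W)
    (Z W1 : groupType) (i : Z -> W1) (p : W1 -> W)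
    (hZ : forall x y : Z, (x * y)%g = (y * x)%g)
    (hext : is_extension i p)
    (R : comPzRingType) (c : W1 -> {fsfun Z -> R with 0})
    (hc : is_parameter D i p c)
    (H : pzRingType) (eta : {rmorphism R -> H}) (T : W1 -> H)
    (hH : is_hecke D i p c eta T)
    (h : H) (hh : in_center h) :
  exists X : set (set W1),
    [/\ finite_set X,
        (forall C, X C -> finite_set C /\ exists x, C = conj_class x) &
        supp_max D p eta T h = \bigcup_(C in X) C].
Proof.
have [x0 x0_off A0_facet] := exists_alcove_point A.
have closed := top_conj_closed hext hH x0_off A0_facet hh.
have top_fin := top_finite hH h.
exists (@conj_class W1 @` supp_max D p eta T h); split.
- exact: finite_image.
- move=> _ [w hw <-]; split; last by exists w.
  apply: sub_finite_set top_fin => _ [x _ <-]; exact: closed.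
- apply/seteqP; split=> w.
    move=> hw; exists (conj_class w); first by exists w.
    by exists 1%g; rewrite // mul1g invg1 mulg1.
  by move=> [_ [v hv <-] [x _ <-]]; exact: closed.
Qed.
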